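(* Fix a real number $\eta$ with $0<\eta<\frac12$. Then (unconditionally) \[ \lim_{x\to\infty}\frac{1}{2x}\sum_{g\in\mathcal{G},\,|g|\le x}\min\{p_g,x^\eta\}=\sum_p p\,\delta_p. \]
   Context: $\mathcal{G}=\{g\in\mathbb{Z}: |g|>1,\ g\text{ not a square}\}$. For an integer $g$, $p_g$ is the least prime $p$ such that $g$ is a primitive root modulo $p$ (i.e. $p\nmid g$ and $g$ generates $(\mathbb{Z}/p\mathbb{Z})^\times$), with $p_g=\infty$ if none exists (so $\min\{p_g,x^\eta\}=x^\eta$ then). For a prime $p$, $\delta_p=\frac{\varphi(p-1)}{p}\prod_{r<p}\Big(1-\frac{\varphi(r-1)}{r}\Big)$, where $r$ runs over primes and $\varphi$ is Euler's totient function; the sum $\sum_p p\delta_p$ is over all primes. *)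

(* Defs.v *)
From mathcomp Require Import all_boot all_order all_algebra all_fingroup cyclic.
From mathcomp Require Import all_classical all_reals all_analysis.

Set Implicit Arguments.
Unset Strict Implicit.
Unset Printing Implicit Defensive.

Import Order.TTheory GRing.Theory Num.Theory.
Import numFieldNormedType.Exports.

Local Open Scope classical_set_scope.
Local Open Scope ring_scope.

Definition nonsquare_set : set int :=
  [set g : int | 1 < `|g| /\ ~ exists k : int, g = k ^+ 2].

(* ['F_p] is the ring Z/pZ only for prime [p], hence the guard.  A unit [u] of
   ['F_p] with value the class of [g] exists exactly when [p] does not divide
   [g]. *)
Definition primitive_root_mod (g : int) (p : nat) : bool :=
  prime p &&
  [exists u : {unit 'F_p},
     (FinRing.uval u == g%:~R) && generator [set: {unit 'F_p}]%SET u].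

Definition least_prime_primitive_root (R : realType) (g : int) : \bar R :=
  if pselect (exists p : nat, primitive_root_mod g p) is left ex_p
  then (ex_minn ex_p)%:R%:E
  else +oo%E.

Definition delta (R : realType) (p : nat) : R :=
  (totient (p - 1))%:R / p%:R *
  \prod_(r < p | prime r) (1 - (totient (r - 1))%:R / r%:R).

Definition nonsquares_upto (R : realType) (x : R) : set int :=
  [set g : int | nonsquare_set g /\ `|g|%:~R <= x].

(* Main.v *)
Require Import Defs.
From mathcomp Require Import all_boot all_order all_algebra all_fingroup cyclic.
From mathcomp Require Import all_classical all_reals all_analysis.
From mathcomp Require Import zify ring lra.

Set Implicit Arguments.
Unset Strict Implicit.
Unset Printing Implicit Defensive.

Import Order.TTheory GRing.Theory Num.Theory.
Import numFieldNormedType.Exports.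

Local Open Scope classical_set_scope.
Local Open Scope ring_scope.

(* The mean of the least primitive root over |g| <= x splits at a fixed power
   2^m.  For p <= 2^m the event "p is the least primitive root" is periodic in g
   and, by the Chinese remainder theorem, has density [delta p].  The tail needs
   the bound N(2^m) = O(X m^4 / 4^m), for 16^m <= X, on the number of |g| <= X
   having no primitive root p <= 2^m; both the tail sum of 2^m N(2^m) / X and
   x^eta N(X^(1/4)) / X are then small, the latter because eta < 1/2.

   The bound is a dual large sieve.  Put f_p(g) = 1 - phi(p-1)/p or -phi(p-1)/p
   according as g is a primitive root mod p or not, and cut the primes up to
   z <= X^(1/4) into two halves P1, P2.  An unsifted g makes
   (sum_P1 f_p(g))^2 (sum_P2 f_q(g))^2 as large as (S1 S2)^2, where
   Si = sum_Pi phi(p-1)/p.  Summed over all g mod M against a Fejer kernel whose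
   frequencies are below 1 / z^4, that product behaves as if the residues of g
   modulo the various primes were exactly independent, and contributes at most
   O(X S1 S2) after normalisation.  Finally Si >> 2^m / m^2 when z = 2^m, by
   Chebyshev's bound and phi(n)/n >> 1 / log n. *)

(** * Chebyshev's lower bound for primes, and a lower bound for Euler's totient *)

Section Arithmetic.
Local Open Scope nat_scope.

Definition primes_upto (n : nat) : seq nat := [seq p <- iota 0 n.+1 | prime p].

Lemma mem_primes_upto n p : (p \in primes_upto n) = prime p && (p <= n).
Proof. by rewrite mem_filter mem_iota. Qed.

Lemma primes_upto_uniq n : uniq (primes_upto n).
Proof. exact/filter_uniq/iota_uniq. Qed.

Lemma leq_exp2_central_bin n : 2 ^ n <= 'C(n.*2, n).
Proof.
elim: n => [|n IHn]; first by rewrite bin0.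
rewrite doubleS binS expnS mul2n -addnn leq_add //.
  by rewrite binS (leq_trans IHn) // leq_addl.
case: n IHn => [|n] IHn; first by rewrite bin0.
by rewrite binS (leq_trans IHn) // leq_addr.
Qed.

(** By Legendre's formula the exponent is the sum over k of floor(2n/p^k) - 2 floor(n/p^k). Each
    term is 0 or 1, and it vanishes once p^k > 2n. *)
Lemma logn_central_bin p n :
  prime p -> 0 < n -> logn p 'C(n.*2, n) <= trunc_log p n.*2.
Proof.
move=> p_pr n_gt0.
have n_le : n <= n.*2 by rewrite -addnn leq_addr.
have E : logn p 'C(n.*2, n) + (logn p n`!).*2 = logn p (n.*2)`!.
  rewrite -(bin_fact n_le).
  have -> : n.*2 - n = n by rewrite -addnn addnK.
  rewrite !lognM ?muln_gt0 ?fact_gt0 ?bin_gt0 ?n_le //.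
  by rewrite addnn.
(* Zero terms are appended so that the sums for n! and (2n)! run over the same range. *)
have Ln : logn p n`! = \sum_(1 <= k < n.*2.+1) n %/ p ^ k.
  rewrite logn_fact // [in RHS](@big_cat_nat _ _ _ n.+1) //=.
  rewrite [X in _ = _ + X]big1_seq ?addn0 // => k.
  rewrite mem_index_iota => /andP[_ /andP[nk _]].
  by rewrite divn_small // (leq_trans nk) // ltnW // ltn_expl // prime_gt1.
have lt_log : trunc_log p n.*2 <= n.*2.
  apply: ltnW; apply: leq_trans (ltn_expl _ (prime_gt1 p_pr)) _.
  by rewrite trunc_logP ?prime_gt1 ?double_gt0.
have: \sum_(1 <= k < n.*2.+1) n.*2 %/ p ^ k <=
  (\sum_(1 <= k < n.*2.+1) (n %/ p ^ k).*2) + trunc_log p n.*2.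
  have -> : trunc_log p n.*2 =
      \sum_(1 <= k < n.*2.+1) (k <= trunc_log p n.*2).
    rewrite (@big_cat_nat _ _ _ (trunc_log p n.*2).+1) //=.
    rewrite [X in _ + X]big1_seq ?addn0.
      rewrite (eq_big_nat _ _ (F2 := fun=> 1)).
        by rewrite sum_nat_const_nat muln1 subn1.
      by move=> k /andP[_]; rewrite ltnS => ->.
    by move=> k; rewrite mem_index_iota => /andP[_ /andP[kl _]]; lia.
  rewrite -big_split /=; apply: leq_sum => k _.
  have [kl|kl] := leqP k (trunc_log p n.*2).
    have pk : 0 < p ^ k by rewrite expn_gt0 prime_gt0.
    have := divn_eq n (p ^ k); have := ltn_pmod n pk.
    move: (n %/ p ^ k) (n %% p ^ k) => q r rlt En.
    rewrite {1}En doubleD doubleMl divnMDl // leq_add2l.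
    by rewrite -ltnS ltn_divLR // ; lia.
  rewrite divn_small //.
  exact: leq_trans (trunc_log_ltn _ (prime_gt1 p_pr)) (leq_pexp2l (prime_gt0 p_pr) kl).
rewrite -logn_fact // -E Ln.
have -> : \sum_(1 <= k < n.*2.+1) (n %/ p ^ k).*2 =
    (\sum_(1 <= k < n.*2.+1) n %/ p ^ k).*2.
  by rewrite -[RHS]addnn -big_split; apply: eq_bigr => k _; rewrite -addnn.
lia.
Qed.

Lemma prod_primes_logn n : 0 < n -> \prod_(p <- primes n) p ^ logn p n = n.
Proof.
move=> n_gt0; rewrite [RHS]prod_prime_decomp // prime_decompE big_map /=.
by apply: eq_bigr.
Qed.

Lemma prime_dvd_fact p n : prime p -> p %| n`! -> p <= n.
Proof.
move=> p_pr; elim: n => [|n IHn]; first by rewrite Euclid_dvd1.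
rewrite factS Euclid_dvdM // => /orP[/dvdn_leq -> //|/IHn /leqW //].
Qed.

(** Every prime factor is at most 2n, since it divides (2n)!, and by [logn_central_bin] its full
    power in the binomial is at most 2n. *)
Lemma central_bin_leq n : 0 < n -> 'C(n.*2, n) <= n.*2 ^ size (primes_upto n.*2).
Proof.
move=> n_gt0.
have n_le : n <= n.*2 by rewrite -addnn leq_addr.
have C_gt0 : 0 < 'C(n.*2, n) by rewrite bin_gt0.
rewrite -{1}(prod_primes_logn C_gt0).
apply: (@leq_trans (\prod_(p <- primes 'C(n.*2, n)) n.*2)).
  rewrite !big_seq; apply: leq_prod => p; rewrite mem_primes => /andP[p_pr _].
  apply: leq_trans (_ : p ^ trunc_log p n.*2 <= _).
    by rewrite leq_pexp2l ?prime_gt0 ?logn_central_bin.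
  by rewrite trunc_logP ?prime_gt1 // double_gt0.
rewrite big_const_seq count_predT iter_muln_1 leq_pexp2l ?double_gt0 //.
apply: uniq_leq_size (primes_uniq _) _ => p.
rewrite mem_primes mem_primes_upto => /and3P[p_pr _ pC]; rewrite p_pr /=.
have : p %| (n.*2)`! by rewrite -(bin_fact n_le) dvdn_mulr.
exact: prime_dvd_fact.
Qed.

(** At n = 2^m both bounds for the central binomial are powers of 2, so it suffices to compare
    exponents. *)
Lemma chebyshev_pow2 m : 2 ^ m <= m.+1 * size (primes_upto (2 ^ m.+1)).
Proof.
have p2 : 0 < 2 ^ m by rewrite expn_gt0.
have E2 : (2 ^ m).*2 = 2 ^ m.+1 by rewrite expnS mul2n.
have := leq_trans (leq_exp2_central_bin (2 ^ m)) (central_bin_leq p2).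
by rewrite E2 -expnM leq_exp2l.
Qed.

(** The i-th entry is at least k + i, so the product of p/(p-1) is at most a telescoping product
    equal to (k + size s)/k. *)
Lemma prod_leq_prod_pred k s : 0 < k -> path ltn k s ->
  (\prod_(p <- s) p) * k <= (\prod_(p <- s) p.-1) * (k + size s).
Proof.
elim: s k => [|p s IHs] k k_gt0 /=; first by rewrite !big_nil addn0.
move=> /andP[kp ps]; rewrite !big_cons.
have := IHs p (leq_ltn_trans (leq0n k) kp) ps.
move: (\prod_(j <- s) j) (\prod_(j <- s) j.-1) (size s) => A B l H.
apply: leq_trans (_ : B * (p + l) * k <= _); 
  first by rewrite leq_mul2r [p * A]mulnC H orbT.
rewrite [p.-1 * B]mulnC -!mulnA leq_mul2l; apply/orP; right.
nia.
Qed.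

(** The ratio n/phi(n) is the product of p/(p-1) over the primes dividing n, to which the
    telescoping bound applies with k = 1. *)
Lemma leq_totient n : 0 < n -> n <= totient n * (size (primes n)).+1.
Proof.
move=> n_gt0.
pose Q := \prod_(p <- primes n) p ^ (logn p n).-1.
have nE : n = (\prod_(p <- primes n) p) * Q.
  rewrite -big_split /= -[LHS](prod_primes_logn n_gt0) !big_seq.
  apply: eq_bigr => p pn; rewrite -expnS prednK //.
  by move: pn; rewrite mem_primes logn_gt0 mem_primes.
have -> : totient n = (\prod_(p <- primes n) p.-1) * Q.
  by rewrite totientE // -big_split.
rewrite [X in X <= _]nE mulnAC leq_mul2r; apply/orP; right.
have := @prod_leq_prod_pred 1 (primes n) isT; rewrite muln1 add1n; apply.
rewrite path_min_sorted ?sorted_primes //.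
by apply/allP => p; rewrite mem_primes => /andP[/prime_gt1].
Qed.

Lemma leq_exp2_size_primes n : 0 < n -> 2 ^ size (primes n) <= n.
Proof.
move=> n_gt0; rewrite -{2}(prod_primes_logn n_gt0).
rewrite -(muln1 (2 ^ _)) -iter_muln -(count_predT (primes n)) -big_const_seq.
rewrite !big_seq; apply: leq_prod => p pn.
have := pn; rewrite mem_primes => /andP[/prime_gt1 p1 _].
rewrite (leq_trans p1) // -{1}[p]expn1 leq_pexp2l ?logn_gt0 //; exact: ltnW.
Qed.

(** A number below 2^m has fewer than m prime factors, so p - 1 <= phi(p-1) m; the factor 2 absorbs
    p <= 2(p-1). *)
Lemma leq_totient_pow2 p m : prime p -> p <= 2 ^ m -> p <= totient p.-1 * m.*2.
Proof.
move=> p_pr pm; have p1 := prime_gt1 p_pr.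
have n0 : 0 < p.-1 by lia.
have le1 := leq_totient n0.
have : size (primes p.-1) < m.
  rewrite -(@ltn_exp2l 2) //; apply: leq_ltn_trans (leq_exp2_size_primes n0) _; lia.
nia.
Qed.

End Arithmetic.

(** * Periodic functions on the integers *)

Lemma periodic_dvd (V : zmodType) (F : int -> V) (a b : nat) :
  (a %| b)%N -> periodic F a%:Z -> periodic F b%:Z.
Proof.
move=> /dvdnP[k ->] Fa u.
have -> : (k * a)%N%:Z = a%:Z *+ k by rewrite PoszM -mulr_natl natz.
exact: periodicn.
Qed.

Lemma periodic_shift (V : zmodType) (F : int -> V) (T c : int) :
  periodic F T -> periodic (fun u => F (u + c)) T.
Proof. by move=> FT u; rewrite addrAC FT. Qed.

Lemma periodic_modn (V : zmodType) (F : int -> V) (a n : nat) :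
  periodic F a%:Z -> F (n %% a)%N%:Z = F n%:Z.
Proof.
move=> Fa; rewrite {2}(divn_eq n a) addnC PoszD.
by rewrite (periodic_dvd (dvdn_mull _ (dvdnn a)) Fa).
Qed.

Lemma sum_periodic_shift (V : zmodType) (F : int -> V) (M : nat) (c : int) :
  periodic F M%:Z -> \sum_(n < M) F (n%:Z + c) = \sum_(n < M) F n%:Z.
Proof.
have shiftn (G : int -> V) (k : nat) : periodic G M%:Z ->
    \sum_(n < M) G (n%:Z + k%:Z) = \sum_(n < M) G n%:Z.
  elim: k G => [|k IHk] G GM; first by under eq_bigr do rewrite addr0.
  have -> : \sum_(n < M) G (n%:Z + k.+1%:Z) = \sum_(n < M) G (n%:Z + 1).
    rewrite -[RHS](IHk (fun u => G (u + 1))); last exact: periodic_shift.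
    by apply: eq_bigr => n _; congr G; lia.
  apply: (@addIr _ (G 0)).
  have -> : \sum_(n < M) G (n%:Z + 1) + G 0 = \sum_(n < M.+1) G n%:Z.
    rewrite big_ord_recl addrC; congr (_ + _).
    by apply: eq_bigr => n _; congr G; rewrite /= /bump /=; lia.
  by rewrite big_ord_recr /=; have := GM 0; rewrite add0r => ->.
move=> FM; case: c => k; first exact: shiftn.
rewrite -(shiftn (fun u => F (u + Negz k)) k.+1); last exact: periodic_shift.
by apply: eq_bigr => n _; congr F; rewrite NegzE; lia.
Qed.

Lemma big_ord_mul (V : zmodType) (F : nat -> V) (a b : nat) :
  \sum_(n < b * a) F n = \sum_(j < b) \sum_(i < a) F (j * a + i)%N.
Proof.
elim: b => [|b IHb]; first by rewrite mul0n !big_ord0.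
by rewrite big_ord_recr /= -IHb mulSnr big_split_ord.
Qed.

(** The Chinese remainder theorem in summed form: write n = ja + i; for fixed i the factor F is
    constant, while j -> ja + i permutes the residues modulo b because a is invertible there. *)
Lemma sum_coprime_periodic (R : comNzRingType) (F G : int -> R) (a b : nat) :
  coprime a b -> periodic F a%:Z -> periodic G b%:Z ->
  \sum_(n < b * a) F n%:Z * G n%:Z =
    (\sum_(n < a) F n%:Z) * \sum_(n < b) G n%:Z.
Proof.
move=> co_ab Fa Gb.
rewrite (big_ord_mul (fun n => F n%:Z * G n%:Z)) exchange_big /= big_distrl /=.
apply: eq_bigr => i _.
rewrite (eq_bigr (fun j : 'I_b => F i%:Z * G (j * a + i)%N%:Z)); last first.
  by move=> j _; rewrite -(periodic_modn (j * a + i) Fa) modnMDl modn_small.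
rewrite -big_distrr /=; congr (_ * _).
case: b co_ab Gb => [|b] co_ab Gb; first by rewrite !big_ord0.
pose h (j : 'I_b.+1) : 'I_b.+1 := inord ((j * a + i) %% b.+1).
have hE j : h j = ((j * a + i) %% b.+1)%N :> nat by rewrite inordK // ltn_mod.
rewrite [RHS](reindex h) /=; last first.
  apply/onW_bij/injF_bij => j k /(congr1 (@nat_of_ord _)).
  rewrite !hE => /eqP; rewrite eqn_modDr.
  wlog kj : j k / (k <= j)%N.
    move=> H; case/orP: (leq_total k j) => [/H //|/H H' e].
    by apply/esym/H'; rewrite eq_sym.
  rewrite eqn_mod_dvd ?leq_mul2r ?kj ?orbT // -mulnBl Gauss_dvdl; last first.
    by rewrite coprime_sym.
  move=> d; apply/val_inj/eqP; rewrite /= eqn_leq kj andbT -subn_eq0.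
  have := ltn_ord j; case: posnP => // lt0; have := dvdn_leq lt0 d; lia.
by apply: eq_bigr => j _; rewrite hE periodic_modn.
Qed.

(** * Means over a period, and independence for coprime periods *)

Section Mean.
Variable R : realType.
Implicit Types F G : int -> R.

Definition mean (M : nat) F : R := M%:R^-1 * \sum_(n < M) F n%:Z.

Lemma eq_mean M F G : F =1 G -> mean M F = mean M G.
Proof. by move=> FG; rewrite /mean; under eq_bigr do rewrite FG. Qed.

Lemma meanD M F G : mean M (fun g => F g + G g) = mean M F + mean M G.
Proof. by rewrite /mean big_split mulrDr. Qed.

Lemma meanZ M (c : R) F : mean M (fun g => c * F g) = c * mean M F.
Proof. by rewrite /mean -mulr_sumr mulrCA. Qed.

Lemma mean_cst M (c : R) : (0 < M)%N -> mean M (fun=> c) = c.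
Proof.
move=> M0; rewrite /mean sumr_const card_ord -[c *+ M]mulr_natl mulrA mulVf ?mul1r //.
by rewrite pnatr_eq0 -lt0n.
Qed.

Lemma mean_sum M (I : Type) (s : seq I) (F : I -> int -> R) :
  mean M (fun g => \sum_(i <- s) F i g) = \sum_(i <- s) mean M (F i).
Proof. by rewrite /mean exchange_big /= mulr_sumr. Qed.

Lemma mean_dvd a M F : (0 < M)%N -> (a %| M)%N -> periodic F a%:Z ->
  mean M F = mean a F.
Proof.
move=> M0 /dvdnP[k Mk] Fa; subst M; move: M0; rewrite muln_gt0 => /andP[k0 a0].
rewrite /mean (big_ord_mul (fun n => F n%:Z)).
rewrite (eq_bigr (fun=> \sum_(n < a) F n%:Z)); last first.
  move=> j _; apply: eq_bigr => i _.
  by rewrite -(periodic_modn _ Fa) modnMDl modn_small.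
rewrite sumr_const card_ord -[_ *+ k]mulr_natl natrM invfM mulrACA mulVf ?mul1r //.
by rewrite pnatr_eq0 -lt0n.
Qed.

Lemma mean_coprime a b M F G : (0 < M)%N -> (a %| M)%N -> (b %| M)%N ->
  coprime a b -> periodic F a%:Z -> periodic G b%:Z ->
  mean M (fun g => F g * G g) = mean M F * mean M G.
Proof.
move=> M0 aM bM co_ab Fa Gb.
have abM : (b * a %| M)%N by rewrite Gauss_dvd ?bM // coprime_sym.
have FGp : periodic (fun g => F g * G g) (b * a)%N%:Z.
  move=> u; rewrite (periodic_dvd (dvdn_mull _ (dvdnn _)) Fa).
  by rewrite (periodic_dvd (dvdn_mulr _ (dvdnn _)) Gb).
rewrite (mean_dvd M0 abM FGp) (mean_dvd M0 aM Fa) (mean_dvd M0 bM Gb).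
by rewrite /mean sum_coprime_periodic // natrM invfM [X in X * _]mulrC mulrACA.
Qed.

Lemma periodic_prod (I : Type) (s : seq I) (e : I -> nat) (F : I -> int -> R) :
  (forall i, periodic (F i) (e i)%:Z) ->
  periodic (fun g => \prod_(i <- s) F i g) (\prod_(i <- s) e i)%N%:Z.
Proof.
move=> Fe; elim: s => [|i s IHs] u; first by rewrite !big_nil.
rewrite !big_cons; rewrite (periodic_dvd (dvdn_mulr _ (dvdnn _)) (Fe i)).
by rewrite (periodic_dvd (dvdn_mull _ (dvdnn _)) IHs).
Qed.

Lemma mean_prod_primes (s : seq nat) M (F : nat -> int -> R) :
  (0 < M)%N -> uniq s -> all prime s -> all (dvdn^~ M) s ->
  (forall p, periodic (F p) p%:Z) ->
  mean M (fun g => \prod_(p <- s) F p g) = \prod_(p <- s) mean M (F p).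
Proof.
move=> M0 us ps ds Fp.
(* The divisibility is carried through the induction because [mean_coprime] needs it for the product
   over the tail. *)
suff [] : (\prod_(p <- s) p %| M)%N /\
  mean M (fun g => \prod_(p <- s) F p g) = \prod_(p <- s) mean M (F p) by [].
elim: s us ps ds => [|p s IHs] /=.
  by rewrite !big_nil dvd1n; under eq_mean do rewrite big_nil; rewrite mean_cst.
move=> /andP[ps us] /andP[p_pr s_pr] /andP[pM sM].
have [dM IH] := IHs us s_pr sM.
have cop : coprime p (\prod_(q <- s) q).
  elim: s ps s_pr {us sM dM IH IHs} => [_ _|q s IH]; first by rewrite big_nil coprimen1.
  rewrite inE negb_or /= => /andP[pq ps] /andP[q_pr s_pr].
  by rewrite big_cons coprimeMr IH // andbT prime_coprime // dvdn_prime2.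
rewrite !big_cons Gauss_dvd // pM dM; split=> //.
under eq_mean do rewrite big_cons.
by rewrite -IH (mean_coprime M0 pM dM cop) //; exact: (@periodic_prod _ _ id).
Qed.

End Mean.

(** * The primitive root condition modulo a prime *)

Lemma periodic_primitive_root_mod p : periodic (primitive_root_mod^~ p) p%:Z.
Proof.
move=> g; rewrite /primitive_root_mod; have [p_pr|//] := boolP (prime p).
by rewrite rmorphD /= -pmulrn pchar_Fp_0 // addr0.
Qed.

(** The unit group of the field is cyclic of order p - 1, hence has phi(p-1) generators. *)
Lemma card_primitive_root_mod p : prime p ->
  (\sum_(n < p) primitive_root_mod n%:Z p)%N = totient p.-1.
Proof.
move=> p_pr.
have card_units : #|[set: {unit 'F_p}]%SET| = p.-1.
  by rewrite card_finField_unit card_Fp.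
have /cyclicP[a aE] := field_unit_group_cyclic [set: {unit 'F_p}]%G.
have card_gen : #|[set u | generator [set: {unit 'F_p}]%SET u]%SET| = totient p.-1.
  by rewrite -card_units aE -orderE totient_gen.
have uval_inj : injective (fun u : {unit 'F_p} => FinRing.uval u) by exact: val_inj.
rewrite -card_gen -(card_imset _ uval_inj) -sum1_card.
rewrite (reindex (cast_ord (Fp_cast p_pr))) /=; last first.
  by exists (cast_ord (esym (Fp_cast p_pr))) => i _; rewrite ?cast_ordK ?cast_ordKV.
rewrite [RHS]big_mkcond; apply: eq_bigr => x _.
rewrite /primitive_root_mod p_pr /= -pmulrn natr_Zp.
set b := [exists u, _]; suff -> : b = (x \in [set FinRing.uval u | u in
    [set u | generator [set: {unit 'F_p}]%SET u]%SET]%SET) by case: (_ \in _).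
apply/existsP/imsetP => [[u /andP[/eqP <- gu]]|[u gu xu]]; exists u => //; first by rewrite inE.
by move: gu; rewrite inE xu eqxx => ->.
Qed.

Section Indicator.
Variable R : realType.

Definition pr_ind (p : nat) (g : int) : R := (primitive_root_mod g p)%:R.

Definition pr_density (p : nat) : R := (totient p.-1)%:R / p%:R.

Lemma periodic_pr_ind p : periodic (pr_ind p) p%:Z.
Proof. by move=> g; rewrite /pr_ind periodic_primitive_root_mod. Qed.

Lemma mean_pr_ind p M : (0 < M)%N -> (p %| M)%N -> prime p ->
  mean M (pr_ind p) = pr_density p.
Proof.
move=> M0 pM p_pr; rewrite (mean_dvd M0 pM (periodic_pr_ind p)).
by rewrite /mean /pr_ind -natr_sum card_primitive_root_mod // mulrC.
Qed.

Lemma pr_density_ge0 p : 0 <= pr_density p.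
Proof. by rewrite divr_ge0. Qed.

Lemma pr_density_le1 p : pr_density p <= 1.
Proof.
have [->|p0] := posnP p; first by rewrite /pr_density invr0 mulr0.
rewrite ler_pdivrMr ?ltr0n // mul1r ler_nat totient_count_coprime.
apply: leq_trans (_ : \sum_(0 <= d < p.-1) 1 <= _)%N.
  by apply: leq_sum => d _; case: coprime.
by rewrite sum_nat_const_nat muln1 subn0 leq_pred.
Qed.

Lemma pr_density_pow2 p m : prime p -> (p <= 2 ^ m)%N ->
  (m.*2)%:R^-1 <= pr_density p.
Proof.
move=> p_pr pm; have p0 := prime_gt0 p_pr.
have m0 : (0 < m.*2)%N.
  by case: m pm => // p1; have := prime_gt1 p_pr; rewrite ltnNge p1.
rewrite ler_pdivlMr ?ltr0n // mulrC ler_pdivrMr ?ltr0n // -natrM ler_nat.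
exact: leq_totient_pow2.
Qed.

Lemma mean_first_primitive_root p M : (0 < M)%N -> prime p ->
  (forall r, prime r -> (r <= p)%N -> (r %| M)%N) ->
  mean M (fun g => pr_ind p g * \prod_(r <- primes_upto p.-1) (1 - pr_ind r g)) =
    delta R p.
Proof.
move=> M0 p_pr divM.
(* Merging the condition at p and the conditions below p into one family lets [mean_prod_primes]
   treat them together. *)
pose F r g : R := if r == p then pr_ind p g else 1 - pr_ind r g.
have p0 := prime_gt0 p_pr.
have pN : p \notin primes_upto p.-1 by rewrite mem_primes_upto p_pr /=; lia.
have Fp r : periodic (F r) r%:Z.
  by rewrite /F => g; case: eqP => [<-|_]; rewrite periodic_pr_ind.
have := @mean_prod_primes R (p :: primes_upto p.-1) M F M0.
rewrite /= pN primes_upto_uniq p_pr divM // => /(_ isT).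
have -> : all prime (primes_upto p.-1).
  by apply/allP => r; rewrite mem_primes_upto => /andP[].
have -> : all (dvdn^~ M) (primes_upto p.-1).
  apply/allP => r; rewrite mem_primes_upto => /andP[r_pr rp] /=; apply: divM => //.
  by rewrite (leq_trans rp) // leq_pred.
have Er r : r \in primes_upto p.-1 -> F r = fun g => 1 - pr_ind r g.
  by move=> rp; apply/funext => g; rewrite /F ifN //; apply: contraTneq rp => ->.
move=> /(_ isT isT Fp); rewrite big_cons => E.
transitivity (mean M (fun g => \prod_(r <- p :: primes_upto p.-1) F r g)).
  apply: eq_mean => g; rewrite big_cons {1}/F eqxx; congr (_ * _).
  by rewrite !big_seq; apply: eq_bigr => r /Er ->.
rewrite E {1}/F eqxx mean_pr_ind ?divM //.
rewrite /delta subn1 -/(pr_density p); congr (_ * _).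
rewrite -(big_mkord prime (fun r => 1 - (totient (r - 1))%:R / r%:R)).
rewrite /index_iota subn0 -(prednK p0) -[in RHS]big_filter -/(primes_upto p.-1).
rewrite !big_seq; apply: eq_bigr => r rp; rewrite Er //.
move: rp; rewrite mem_primes_upto => /andP[r_pr rp].
rewrite meanD mean_cst //; congr (_ + _).
rewrite -[RHS]mulN1r subn1 -/(pr_density r) -(@mean_pr_ind r M) //.
  by rewrite -meanZ; apply: eq_mean => g; rewrite mulN1r.
by apply: divM => //; move: rp => /=; lia.
Qed.

End Indicator.

(** * The Fejer weight *)

Section FejerWeight.
Variable R : realType.

Lemma cosB2npi_neq1 (t : R) : 0 < t < pi *+ 2 -> cos t != 1.
Proof.
move=> /andP[t0 t2]; have /andP[h0 h1] : 0 < t / 2 < pi.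
  by rewrite divr_gt0 //= ltr_pdivrMr // mulr_natr.
have := sin_gt0_pi; move=> /(_ _ (t / 2)); rewrite h0 h1 => /(_ isT) s0.
have -> : t = (t / 2) *+ 2 by rewrite mulr2n -splitr.
rewrite cos_mulr2n cos2sin2; apply/eqP => E.
have : sin (t / 2) ^+ 2 = 0 by move: E; rewrite [(1 - _) *+ 2]mulr2n; lra.
by move/eqP; rewrite sqrf_eq0 gt_eqF.
Qed.

(** Since pi >= 2, the angle 2t still has positive cosine, so 2 cos(t)^2 > 1 with cos t > 0. *)
Lemma cos_gt_half (t : R) : `|t| <= 4^-1 -> 2^-1 < cos t.
Proof.
rewrite ler_norml => /andP[t1 t2].
have pi2 := pi_ge2 R.
have c1 : 0 < cos (t *+ 2).
  apply: cos_gt0_pihalf; rewrite [t *+ 2]mulr2n; apply/andP; split; lra.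
have c2 : 0 < cos t by apply: cos_gt0_pihalf; apply/andP; split; lra.
move: c1; rewrite cos_mulr2n [_ *+ 2]mulr2n expr2; nra.
Qed.

(* Shifting the summation variable by L multiplies the sum of e(kn/M) G(n) over
   n mod M by e(-kL/M), which is not 1. *)
Lemma sum_cos_periodic (G : int -> R) (M L k : nat) (c : int) :
  (L %| M)%N -> (0 < k * L < M)%N -> periodic G L%:Z ->
  let th := pi *+ 2 / M%:R in
  \sum_(n < M) cos (th * (k%:Z * (n%:Z + c))%:~R) * G (n%:Z + c) = 0.
Proof.
move=> LM /andP[kL0 kLM] GL th.
have M0 : (0 < M)%N by apply: leq_trans kLM.
have GM := periodic_dvd LM GL.
pose C g : R := cos (th * (k%:Z * g)%:~R) * G g.
pose S g : R := sin (th * (k%:Z * g)%:~R) * G g.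
have shiftE (u : int) : th * (k%:Z * (u + M%:Z))%:~R = th * (k%:Z * u)%:~R + pi *+ 2 *+ k.
  rewrite mulrDr rmorphD mulrDr /=; congr (_ + _).
  rewrite rmorphM /= -!pmulrn mulrCA /th divfK ?pnatr_eq0 -?lt0n //.
  by rewrite mulr_natl.
have CM : periodic C M%:Z.
  by move=> u; rewrite /C GM shiftE (periodicn (@cosD2pi R)).
have SM : periodic S M%:Z.
  by move=> u; rewrite /S GM shiftE (periodicn (@sinD2pi R)).
rewrite (sum_periodic_shift c CM).
pose al : R := th * (k * L)%N%:R.
have shiftL (u : int) : th * (k%:Z * (u + L%:Z))%:~R = th * (k%:Z * u)%:~R + al.
  by rewrite mulrDr rmorphD mulrDr.
have EC : \sum_(n < M) C n%:Z =
    cos al * \sum_(n < M) C n%:Z - sin al * \sum_(n < M) S n%:Z.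
  rewrite -{1}(sum_periodic_shift L%:Z CM) !mulr_sumr -sumrB.
  by apply: eq_bigr => n _; rewrite /C /S GL shiftL cosD; ring.
have ES : \sum_(n < M) S n%:Z =
    sin al * \sum_(n < M) C n%:Z + cos al * \sum_(n < M) S n%:Z.
  rewrite -{1}(sum_periodic_shift L%:Z SM) !mulr_sumr -big_split.
  by apply: eq_bigr => n _; rewrite /C /S GL shiftL sinD /=; ring.
have al1 : cos al != 1.
  apply: cosB2npi_neq1; rewrite /al /th.
  have pi0 : 0 < pi *+ 2 :> R by rewrite pmulrn_lgt0 ?pi_gt0.
  rewrite mulrAC divr_gt0 ?mulr_gt0 ?ltr0n //=.
  by rewrite ltr_pdivrMr ?ltr0n // ltr_pM2l // ltr_nat.
move: EC ES al1 (cos2Dsin2 al).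
move: (cos al) (sin al) (\sum_(n < M) C n) (\sum_(n < M) S n) => x y p q.
move=> Ep Eq x1 xy1.
(* The real 2 x 2 system has determinant (1-x)^2 + y^2 = 2(1-x), which is nonzero; eliminating q
   gives p = 0. *)
have E1 : (1 - x) * p = - y * q by rewrite [in LHS]mulrBl mul1r {1}Ep; ring.
have E2 : (1 - x) * q = y * p by rewrite [in LHS]mulrBl mul1r {1}Eq; ring.
have E3 : (1 - x) * ((1 - x) * p + y * q) = 0.
  by rewrite E1; ring.
have E4 : 2 * (1 - x) * p = 0.
  have -> : 2 * (1 - x) * p = (1 - x) * ((1 - x) * p) + y * (y * p).
    have yy : y * y = 1 - x ^+ 2 by rewrite -expr2 -xy1; ring.
    by rewrite !mulrA -expr2 yy; ring.
  by rewrite -E2 E1; ring.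
move/eqP: E4; rewrite !mulf_eq0 pnatr_eq0 /= subr_eq0 eq_sym (negPf x1) /=.
by move/eqP.
Qed.

(** The unnormalised Fejer kernel |sum of e(kg/M) over k < H|^2, split into real and imaginary parts
    so that it is visibly nonnegative. *)
Definition fejer (H M : nat) (g : int) : R :=
  let th := pi *+ 2 / M%:R in
  (\sum_(k < H) cos (th * (k%:Z * g)%:~R)) ^+ 2 +
  (\sum_(k < H) sin (th * (k%:Z * g)%:~R)) ^+ 2.

Lemma fejer_ge0 H M g : 0 <= fejer H M g.
Proof. by rewrite addr_ge0 ?sqr_ge0. Qed.

(** Evenness of cosine replaces k - l by its absolute value, the natural-number frequency that
    [sum_cos_periodic] takes. *)
Lemma fejerE H M g : let th := pi *+ 2 / M%:R in
  fejer H M g = \sum_(k < H) \sum_(l < H) cos (th * (`|k%:Z - l%:Z|%N%:Z * g)%:~R).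
Proof.
move=> th; rewrite /fejer -/th !expr2 !big_distrlr /= -big_split /=.
apply: eq_bigr => k _; rewrite -big_split /=; apply: eq_bigr => l _.
rewrite -cosB -mulrBr -rmorphB /= -mulrBl abszE.
case: (lerP 0 (k%:Z - l%:Z)) => h; first by rewrite ger0_norm.
by rewrite ltr0_norm // mulNr rmorphN mulrN cosN.
Qed.

(** As pi <= 4, every angle is at most 8HX/M <= 1/4, so each cosine in the sum exceeds 1/2; the sine
    part is dropped. *)
Lemma fejer_lb H M X g : (0 < M)%N -> (32 * X * H <= M)%N -> (`|g| <= X)%N ->
  (H%:R / 2) ^+ 2 <= fejer H M g.
Proof.
move=> M0 HM gX; pose th : R := pi *+ 2 / M%:R; rewrite /fejer -/th.
have : H%:R / 2 <= \sum_(k < H) cos (th * (k%:Z * g)%:~R).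
  rewrite -[H in X in X <= _]card_ord mulrC mulr_natr -sumr_const.
  apply: ler_sum => k _; apply/ltW/cos_gt_half.
  rewrite normrM.
  have -> : `|(k%:Z * g)%:~R| = (k * `|g|)%N%:R :> R.
    by rewrite -intr_norm pmulrn -abszE abszM.
  rewrite [`|th|]ger0_norm; last by rewrite divr_ge0 // mulrn_wge0 ?pi_ge0.
  rewrite /th mulrAC ler_pdivrMr ?ltr0n //.
  have kg : ((k * `|g|)%N%:R : R) <= (H * X)%N%:R.
    by rewrite ler_nat leq_mul // ltnW.
  have pi4 : pi <= 4 :> R by have [/andP[_]] := pihalf_02_cos_pihalf R; lra.
  have : (32 * X * H)%N%:R <= M%:R :> R by rewrite ler_nat.
  have -> : (32 * X * H = 32 * (H * X))%N by lia.
  have a0 : 0 <= (k * `|g|)%N%:R :> R by [].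
  rewrite [in (32 * _)%N%:R]natrM [@pi R *+ 2]mulr2n => h.
  move: kg a0 h pi4 (pi_ge0 R).
  move: ((k * `|g|)%N%:R : R) ((H * X)%N%:R : R) => A B AB A0 h pi4 pi0.
  have := ler_wpM2r A0 pi4; lra.
have H0 : 0 <= H%:R / 2 :> R by rewrite divr_ge0 ?ler0n.
move=> h; rewrite -[leLHS]addr0 lerD ?sqr_ge0 //.
by rewrite lerXn2r // nnegrE (le_trans H0).
Qed.

(* The frequencies of the kernel lie within H/M of 0, so for L <= M/H it gives
   every residue class modulo L exactly the same mass. *)
Lemma sum_fejer_periodic (G : int -> R) (H M L : nat) (c : int) :
  (0 < M)%N -> (L %| M)%N -> (L * H <= M)%N -> periodic G L%:Z ->
  \sum_(n < M) fejer H M (n%:Z + c) * G (n%:Z + c) =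
    H%:R * \sum_(n < M) G n%:Z.
Proof.
move=> M0 LM LHM GL; pose th : R := pi *+ 2 / M%:R.
have L0 : (0 < L)%N := dvdn_gt0 M0 LM.
under eq_bigr do rewrite fejerE big_distrl.
rewrite exchange_big /= -[H in RHS]card_ord mulr_natl -sumr_const.
apply: eq_bigr => k _; under eq_bigr do rewrite big_distrl.
rewrite exchange_big /= (bigD1 k) //= [X in _ + X]big1 ?addr0; last first.
  move=> l lk; apply: (sum_cos_periodic (L := L)) => //.
  have := ltn_ord k; have := ltn_ord l; move: lk; rewrite -val_eqE /= => lk lH kH.
  rewrite muln_gt0 L0 andbT; apply/andP; split; first lia.
  apply: leq_trans LHM; rewrite mulnC ltn_pmul2l //; lia.
rewrite -(sum_periodic_shift c (periodic_dvd LM GL)); apply: eq_bigr => n _.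
by rewrite subrr mul0r mulr0 cos0 mul1r.
Qed.

End FejerWeight.

(** * The sieve *)

Section Sieve.
Variable R : realType.

Definition survivor (s : seq nat) (g : int) : R := \prod_(p <- s) (1 - pr_ind R p g).

Lemma survivorE s g :
  survivor s g = (all (fun p => ~~ primitive_root_mod g p) s)%:R.
Proof.
rewrite /survivor; elim: s => [|p s IHs]; first by rewrite big_nil.
rewrite big_cons IHs /= /pr_ind.
by case: primitive_root_mod; rewrite /= ?subrr ?mul0r ?subr0 ?mul1r.
Qed.

Let f (p : nat) (g : int) : R := pr_ind R p g - pr_density R p.

Let periodic_f p : periodic (f p) p%:Z.
Proof. by move=> g; rewrite /f periodic_pr_ind. Qed.

Let mean_f p M : (0 < M)%N -> (p %| M)%N -> prime p -> mean M (f p) = 0.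
Proof.
by move=> M0 pM p_pr; rewrite /f meanD mean_pr_ind // mean_cst // subrr.
Qed.

Let mean_f_sqr p M : (0 < M)%N -> (p %| M)%N -> prime p ->
  0 <= mean M (fun g => f p g * f p g) <= pr_density R p.
Proof.
move=> M0 pM p_pr; set a := pr_density R p.
have -> : mean M (fun g => f p g * f p g) = a * (1 - a).
  transitivity (mean M (fun g => (1 - 2 * a) * pr_ind R p g + a ^+ 2)).
    apply: eq_mean => g; rewrite /f -/a /pr_ind.
    by case: primitive_root_mod => /=; ring.
  rewrite meanD meanZ mean_cst // mean_pr_ind // -/a; ring.
have a0 : 0 <= a := pr_density_ge0 R p; have a1 : a <= 1 := pr_density_le1 R p.
rewrite mulr_ge0 ?subr_ge0 //=; nra.
Qed.

(** If p differs from p', then p is coprime to p', q and q', so the mean-zero factor at p splits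
    off; likewise for q. Taking the two pairs from disjoint lists excludes the cross pairings p =
    q. *)
Let mean_f4 M (P1 P2 : seq nat) p p' q q' :
  (0 < M)%N -> uniq (P1 ++ P2) -> all prime (P1 ++ P2) ->
  all (dvdn^~ M) (P1 ++ P2) ->
  (p * p' * (q * q') %| M)%N ->
  p \in P1 -> p' \in P1 -> q \in P2 -> q' \in P2 ->
  mean M (fun g => (f p g * f p' g) * (f q g * f q' g)) =
  (if p' == p then mean M (fun g => f p g * f p g) else 0) *
  (if q' == q then mean M (fun g => f q g * f q g) else 0).
Proof.
move=> M0; rewrite cat_uniq !all_cat => /and3P[u1 /hasPn d12 u2].
move=> /andP[/allP pr1 /allP pr2] /andP[/allP dv1 /allP dv2] dvM p1 p1' q2 q2'.
have neq (r s : nat) : r \in P1 -> s \in P2 -> coprime r s.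
  move=> rP sP; rewrite prime_coprime ?(pr1 r rP) // dvdn_prime2 ?(pr1 r rP) //; last exact: pr2.
  by apply/eqP => rs; have := d12 s sP; rewrite -rs rP.
have per : forall r s, periodic (fun g => f r g * f s g) (r * s)%N%:Z.
  move=> r s g; rewrite (periodic_dvd (dvdn_mulr _ (dvdnn _)) (@periodic_f r)).
  by rewrite (periodic_dvd (dvdn_mull _ (dvdnn _)) (@periodic_f s)).
have per3 : forall r F (L : nat), periodic F L%:Z ->
    periodic (fun g => f r g * F g) (r * L)%N%:Z.
  move=> r F L FL g; rewrite (periodic_dvd (dvdn_mulr _ (dvdnn _)) (@periodic_f r)).
  by rewrite (periodic_dvd (dvdn_mull _ (dvdnn _)) FL).
have [pp|pp] := altP (p' =P p); last first.
  rewrite mul0r.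
  transitivity (mean M (fun g => f p g * (f p' g * (f q g * f q' g)))).
    by apply: eq_mean => g; ring.
  rewrite (@mean_coprime _ p (p' * (q * q'))) ?mean_f ?mul0r ?(pr1 p p1) ?(dv1 p p1) //.
  - by apply: dvdn_trans dvM; rewrite -mulnA dvdn_mull.
  - rewrite !coprimeMr (neq p q) // (neq p q') // !andbT prime_coprime ?(pr1 p p1) //.
    by rewrite dvdn_prime2 ?(pr1 p p1) ?(pr1 p' p1') // eq_sym.
  - exact: per3.
rewrite {p' p1'}pp in dvM *.
have [qq|qq] := altP (q' =P q); last first.
  rewrite mulr0.
  transitivity (mean M (fun g => f q g * (f q' g * (f p g * f p g)))).
    by apply: eq_mean => g; ring.
  rewrite (@mean_coprime _ q (q' * (p * p))) ?mean_f ?mul0r ?(pr2 q q2) ?(dv2 q q2) //.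
  - apply: dvdn_trans dvM; rewrite -[(_ * _ * (_ * _))%N]mulnC -[(q * q' * _)%N]mulnA.
    by rewrite dvdn_mull.
  - rewrite !coprimeMr [coprime q p]coprime_sym (neq p q) // !andbT.
    rewrite prime_coprime ?(pr2 q q2) //.
    by rewrite dvdn_prime2 ?(pr2 q q2) ?(pr2 q' q2') // eq_sym.
  - exact: per3.
rewrite {q' q2'}qq in dvM *.
rewrite (@mean_coprime _ (p * p) (q * q)) //.
- exact: dvdn_trans (dvdn_mulr _ (dvdnn _)) dvM.
- exact: dvdn_trans (dvdn_mull _ (dvdnn _)) dvM.
- by rewrite !coprimeMl !coprimeMr !neq.
Qed.

Let sum_diag (s : seq nat) (v : nat -> R) : uniq s ->
  \sum_(p <- s) \sum_(p' <- s) (if p' == p then v p else 0) = \sum_(p <- s) v p.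
Proof.
move=> us; rewrite !big_seq; apply: eq_bigr => p ps.
by rewrite (bigD1_seq p) //= eqxx big1 ?addr0 // => i /negPf ->.
Qed.

(** With N the number of survivors, the weighted fourth moment is at least N (H/2)^2 (S1 S2)^2 and
    at most H M S1 S2. Since M = 32 X H, this gives 4 * 32 = 128. *)
Lemma sieve_bound (z X : nat) (P1 P2 : seq nat) :
  (0 < X)%N -> (z ^ 4 <= X)%N ->
  uniq (P1 ++ P2) -> all prime (P1 ++ P2) -> all (leq^~ z) (P1 ++ P2) ->
  (\sum_(n < (2 * X).+1) survivor (P1 ++ P2) (n%:Z - X%:Z)) *
    ((\sum_(p <- P1) pr_density R p) * (\sum_(p <- P2) pr_density R p)) <=
    128 * X%:R.
Proof.
move=> X0 zX u12 pr12 le12; set S1 := \sum_(p <- P1) _; set S2 := \sum_(p <- P2) _.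
(* The fourth power makes every product p p' q q' divide H, hence M; the factor 32 X meets the
   hypothesis of [fejer_lb]. *)
pose H := (z`! ^ 4)%N; pose M := (32 * X * H)%N.
have H0 : (0 < H)%N by rewrite expn_gt0 fact_gt0.
have M0 : (0 < M)%N by rewrite /M muln_gt0 H0 andbT muln_gt0.
have HM : (H %| M)%N by rewrite dvdn_mull.
have dz p : p \in P1 ++ P2 -> (p %| z`!)%N.
  move=> ps; rewrite dvdn_fact // (allP le12 p ps) andbT.
  exact/prime_gt0/(allP pr12).
have dH p p' q q' : p \in P1 ++ P2 -> p' \in P1 ++ P2 -> q \in P1 ++ P2 ->
    q' \in P1 ++ P2 -> (p * p' * (q * q') %| H)%N.
  move=> /dz pz /dz pz' /dz qz /dz qz'.
  by rewrite /H (expnD _ 2 2) -mulnn !dvdn_mul.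
have ME : M = (32 * X * H)%N by [].
clearbody M; clearbody H.
have dM : all (dvdn^~ M) (P1 ++ P2).
  apply/allP => p ps; apply: dvdn_trans HM; apply: dvdn_trans (dH p p p p ps ps ps ps).
  by rewrite -mulnA dvdn_mulr.
pose Af g := \sum_(p <- P1) f p g; pose Bf g := \sum_(p <- P2) f p g.
pose Lam (F : int -> R) :=
  \sum_(n < M) fejer R H M (n%:Z + - X%:Z) * F (n%:Z + - X%:Z).
have LamS (s : seq nat) (F : nat -> int -> R) :
    Lam (fun g => \sum_(i <- s) F i g) = \sum_(i <- s) Lam (F i).
  by rewrite /Lam; under eq_bigr do rewrite mulr_sumr; rewrite exchange_big.
pose v p := mean M (fun g => f p g * f p g).
have LamE : Lam (fun g => Af g * Af g * (Bf g * Bf g)) =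
    H%:R * M%:R * ((\sum_(p <- P1) v p) * (\sum_(p <- P2) v p)).
  have /funext -> : (fun g => Af g * Af g * (Bf g * Bf g)) =1 (fun g =>
      \sum_(p <- P1) \sum_(p' <- P1) \sum_(q <- P2) \sum_(q' <- P2)
        (f p g * f p' g) * (f q g * f q' g)).
    move=> g; rewrite /Af /Bf [X in X * _]big_distrlr [X in _ * X]big_distrlr /=.
    rewrite big_distrl /=.
    apply: eq_bigr => p _; rewrite big_distrl; apply: eq_bigr => p' _ /=.
    rewrite big_distrr; apply: eq_bigr => q _ /=.
    by rewrite big_distrr.
  have [u1 u2] : uniq P1 /\ uniq P2.
    by move: u12; rewrite cat_uniq => /and3P[].
  rewrite -(sum_diag v u1) -(sum_diag v u2) big_distrl big_distrr LamS /=.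
  rewrite !big_seq; apply: eq_bigr => p p1.
  rewrite /= LamS big_distrl big_distrr !big_seq; apply: eq_bigr => p' p1' /=.
  rewrite LamS big_distrr big_distrr !big_seq; apply: eq_bigr => q q2 /=.
  rewrite LamS big_distrr big_distrr !big_seq; apply: eq_bigr => q' q2' /=.
  have pP : p \in P1 ++ P2 by rewrite mem_cat p1.
  have pP' : p' \in P1 ++ P2 by rewrite mem_cat p1'.
  have qP : q \in P1 ++ P2 by rewrite mem_cat q2 orbT.
  have qP' : q' \in P1 ++ P2 by rewrite mem_cat q2' orbT.
  have LM : (p * p' * (q * q') %| M)%N.
    exact: dvdn_trans (dH _ _ _ _ pP pP' qP qP') HM.
  (* The period p p' q q' is at most z^4 <= X, short enough for the kernel to weigh its residue
     classes equally. *)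
  have LX : (p * p' * (q * q') * H <= M)%N.
    rewrite ME leq_mul2r; apply/orP; right.
    apply: leq_trans (_ : X <= _)%N; last by rewrite leq_pmull.
    apply: leq_trans zX; rewrite (expnD _ 2 2) -!mulnn.
    by rewrite !leq_mul ?(allP le12).
  have perG : periodic (fun g => f p g * f p' g * (f q g * f q' g))
      (p * p' * (q * q'))%N%:Z.
    move=> g; congr (_ * _ * (_ * _)).
    - by apply: (periodic_dvd _ (@periodic_f p)); rewrite -mulnA dvdn_mulr.
    - by apply: (periodic_dvd _ (@periodic_f p')); rewrite dvdn_mulr // dvdn_mull.
    - by apply: (periodic_dvd _ (@periodic_f q)); rewrite dvdn_mull // dvdn_mulr.
    - by apply: (periodic_dvd _ (@periodic_f q')); rewrite dvdn_mull // dvdn_mull.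
  rewrite /Lam; apply: etrans (sum_fejer_periodic (- X%:Z) M0 LM LX perG) _.
  rewrite -mulrA -(mean_f4 M0 u12 pr12) //; congr (_ * _).
  by rewrite /mean mulrA mulfV ?mul1r // pnatr_eq0 -lt0n.
have LamLe : Lam (fun g => Af g * Af g * (Bf g * Bf g)) <=
    H%:R * M%:R * (S1 * S2).
  have vb (s : seq nat) : {subset s <= P1 ++ P2} ->
      0 <= \sum_(p <- s) v p <= \sum_(p <- s) pr_density R p.
    move=> sP; rewrite big_seq sumr_ge0 => [|p ps] /=; last first.
      by have /andP[] := mean_f_sqr M0 (allP dM p (sP p ps)) (allP pr12 p (sP p ps)).
    rewrite [leRHS]big_seq; apply: ler_sum => p ps.
    by have /andP[] := mean_f_sqr M0 (allP dM p (sP p ps)) (allP pr12 p (sP p ps)).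
  have /andP[v1 v1S] : 0 <= \sum_(p <- P1) v p <= S1.
    by apply: vb => p; rewrite mem_cat => ->.
  have /andP[v2 v2S] : 0 <= \sum_(p <- P2) v p <= S2.
    by apply: vb => p; rewrite mem_cat orbC => ->.
  by rewrite LamE ler_wpM2l ?mulr_ge0 ?ler0n // ler_pM.
have S1_ge0 : 0 <= S1 by apply: sumr_ge0 => p _; exact: pr_density_ge0.
have S2_ge0 : 0 <= S2 by apply: sumr_ge0 => p _; exact: pr_density_ge0.
set N := \sum_(n < _) _.
(* Terms with |g| > X are nonnegative and are discarded; at a survivor each f_p equals minus its
   density, so the two sums are -S1 and -S2. *)
have NLe : N * (H%:R / 2) ^+ 2 * (S1 * S2) ^+ 2 <=
    Lam (fun g => Af g * Af g * (Bf g * Bf g)).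
  have XM : ((2 * X).+1 <= M)%N by rewrite ME; nia.
  rewrite /N /Lam -(big_mkord xpredT (fun n => survivor (P1 ++ P2) (n%:Z - X%:Z))).
  rewrite -(big_mkord xpredT (fun n => fejer R H M (n%:Z + - X%:Z) *
    (Af (n%:Z + - X%:Z) * Af (n%:Z + - X%:Z) *
     (Bf (n%:Z + - X%:Z) * Bf (n%:Z + - X%:Z))))).
  rewrite [leRHS](@big_cat_nat _ _ _ (2 * X).+1) //= -[leLHS]addr0.
  have Lge0 g : 0 <= fejer R H M g * (Af g * Af g * (Bf g * Bf g)).
    by rewrite mulr_ge0 ?fejer_ge0 // -!expr2 mulr_ge0 ?sqr_ge0.
  apply: lerD; last by apply: sumr_ge0.
  rewrite -mulrA mulr_suml !big_nat; apply: ler_sum => n /andP[_ nX].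
  rewrite survivorE; case: allP => [surv|_]; last by rewrite /= !mul0r.
  have fE p : p \in P1 ++ P2 -> f p (n%:Z - X%:Z) = - pr_density R p.
    by move=> /surv; rewrite /f /pr_ind => /negPf -> /=; rewrite sub0r.
  have -> : Af (n%:Z - X%:Z) = - S1.
    rewrite /Af /S1 -sumrN !big_seq; apply: eq_bigr => p pP.
    by rewrite fE // mem_cat pP.
  have -> : Bf (n%:Z - X%:Z) = - S2.
    rewrite /Bf /S2 -sumrN !big_seq; apply: eq_bigr => p pP.
    by rewrite fE // mem_cat pP orbT.
  rewrite mul1r !mulrNN (_ : S1 * S1 * _ = (S1 * S2) ^+ 2); last by ring.
  rewrite ler_wpM2r ?sqr_ge0 //.
  by apply: (@fejer_lb _ _ _ X) => //; lia.
have [S0|S_neq0] := eqVneq (S1 * S2) 0; first by rewrite S0 mulr0 mulr_ge0.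
have S_gt0 : 0 < S1 * S2 by rewrite lt_neqAle eq_sym S_neq0 mulr_ge0.
have := le_trans NLe LamLe.
have -> : M%:R = 32 * X%:R * H%:R :> R by rewrite ME !natrM.
have HR : 0 < H%:R :> R by rewrite ltr0n.
have W_gt0 : 0 < (H%:R / 2) ^+ 2 * (S1 * S2).
  by rewrite mulr_gt0 // exprn_gt0 // divr_gt0.
rewrite -[in X in _ -> X](ler_pM2r W_gt0).
by congr (_ <= _); field.
Qed.
End Sieve.

(** * Sums over the integers g with |g| <= X *)

Section IntervalSum.
Variable R : realType.
Implicit Types F G : int -> R.

Definition isum (X : nat) F : R := \sum_(n < (2 * X).+1) F (n%:Z - X%:Z).

Lemma ler_isum X F G : (forall g, F g <= G g) -> isum X F <= isum X G.
Proof. by move=> FG; apply: ler_sum. Qed.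

Lemma isumD X F G : isum X (fun g => F g + G g) = isum X F + isum X G.
Proof. exact: big_split. Qed.

Lemma isumZ X (c : R) F : isum X (fun g => c * F g) = c * isum X F.
Proof. by rewrite /isum mulr_sumr. Qed.

(** After the mean is subtracted, complete periods cancel and one incomplete period remains. The
    term [|mu|] in the bound pays for the interval having 2X + 1 points instead of 2X. *)
Lemma isum_periodic M F : (0 < M)%N -> periodic F M%:Z ->
  exists K, forall X, `|isum X F - 2 * X%:R * mean M F| <= K.
Proof.
move=> M0 FM; pose mu := mean M F; pose G g := F g - mu.
have GM : periodic G M%:Z by move=> g; rewrite /G FM.
have nGM : periodic (fun g => `|G g|) M%:Z by move=> g; rewrite GM.
exists (\sum_(n < M) `|G n%:Z| + `|mu|) => X.
have -> : isum X F - 2 * X%:R * mu = \sum_(n < (2 * X).+1) G (n%:Z - X%:Z) + mu.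
  rewrite /isum /G sumrB sumr_const card_ord -[mu *+ _]mulr_natl.
  rewrite -[(2 * X).+1]addn1 natrD natrM.
  by ring.
apply: le_trans (ler_normD _ _) _; rewrite lerD2r.
rewrite (divn_eq (2 * X).+1 M) big_split_ord /=.
set k := (_ %/ _)%N; set r := (_ %% _)%N.
have rM : (r <= M)%N by rewrite ltnW // ltn_mod.
have -> : \sum_(i < k * M) G (i%:Z - X%:Z) = 0.
  rewrite (big_ord_mul (fun n => G (n%:Z - X%:Z))).
  rewrite big1 // => j _.
  have -> : \sum_(i < M) G ((j * M + i)%N%:Z - X%:Z) =
      \sum_(i < M) G (i%:Z + ((j * M)%N%:Z - X%:Z)).
    by apply: eq_bigr => i _; congr G; lia.
  rewrite sum_periodic_shift // /G sumrB sumr_const card_ord /mu /mean.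
  by rewrite -[_ *+ M]mulr_natl mulVKf ?subrr // pnatr_eq0 -lt0n.
rewrite add0r; apply: le_trans (ler_norm_sum _ _ _) _.
rewrite -(sum_periodic_shift ((k * M)%N%:Z - X%:Z) nGM).
rewrite -!(big_mkord xpredT (fun i => `|G (i%:Z + _)|)).
rewrite [leRHS](@big_cat_nat _ _ _ r) //= -[leLHS]addr0 lerD ?sumr_ge0 //.
rewrite -(big_mkord xpredT (fun i => `|G ((k * M + i)%N%:Z - X%:Z)|)).
by rewrite le_eqVlt; apply/orP; left; apply/eqP/eq_bigr => i _; congr (`|G _|); lia.
Qed.

End IntervalSum.

(** * The sieve bound at dyadic levels *)

Section Survivors.
Variable R : realType.

Definition unsifted (m : nat) : int -> R := survivor R (primes_upto (2 ^ m)).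

Lemma unsifted_ge0 m g : 0 <= unsifted m g.
Proof. by rewrite /unsifted survivorE. Qed.

Lemma sum_pr_density_ge (m : nat) (s : seq nat) :
  all prime s -> all (leq^~ (2 ^ m)%N) s ->
  (size s)%:R / (m.*2)%:R <= \sum_(p <- s) pr_density R p.
Proof.
elim: s => [|p s IHs] /=; first by rewrite mul0r big_nil.
move=> /andP[p_pr s_pr] /andP[pm sm]; rewrite big_cons -add1n natrD mulrDl mul1r.
by rewrite lerD ?IHs // pr_density_pow2.
Qed.

Lemma isum_unsifted : exists2 K : R, 0 <= K &
  forall m X, (0 < X)%N -> (16 ^ m <= X)%N ->
    isum X (unsifted m) <= K * X%:R * (m.+1%:R ^+ 4 / 4 ^+ m).
Proof.
(* The 128 comes from [sieve_bound], and 144 = 12^2 from the bound 2^m / (12 m^2) for each of S1 and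
   S2. *)
exists (128 * 144) => [|m X X0 mX]; first by rewrite -natrM ler0n.
have X1 : 1 <= X%:R :> R by rewrite ler1n.
(* Below m = 2 there is at most one prime, so one half would be empty; the trivial bound 3X
   suffices. *)
have [m2|m2] := ltnP m 2.
  have : isum X (unsifted m) <= 3 * X%:R.
    apply: (@le_trans _ _ (isum X (fun=> 1))).
      by apply: ler_isum => g; rewrite /unsifted survivorE lern1 leq_b1.
    rewrite /isum sumr_const card_ord -addn1 natrD natrM; lra.
  have : 4^-1 <= m.+1%:R ^+ 4 / 4 ^+ m :> R.
    by case: m m2 {mX} => [|[|]] // _; rewrite ?expr0 ?expr1 ?expr1n; lra.
  nra.
have m0 : (0 < m)%N by lia.
pose s := primes_upto (2 ^ m); pose k := size s.
have sk : (2 ^ m <= 2 * m * k)%N.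
  have := chebyshev_pow2 m.-1; rewrite (prednK m0) -/s -/k => h.
  by rewrite -{1}(prednK m0) expnS -mulnA leq_mul2l.
(* With at least two primes, each half contains at least k/3 of them. *)
have k2 : (1 < k)%N.
  have : {subset [:: 2; 3] <= s}.
    move=> p; rewrite !inE mem_primes_upto => /orP[]/eqP-> /=.
      by rewrite (leq_trans (_ : 2 <= 2 ^ 2)%N) // leq_exp2l.
    by rewrite (leq_trans (_ : 3 <= 2 ^ 2)%N) // leq_exp2l.
  by move/uniq_leq_size; apply.
have s_pr : all prime s by apply/allP => p; rewrite mem_primes_upto => /andP[].
have s_le : all (leq^~ (2 ^ m)%N) s by apply/allP => p; rewrite mem_primes_upto => /andP[].
have s_u : uniq s by exact: primes_upto_uniq.
have m2_gt0 : 0 < m.*2%:R :> R by rewrite ltr0n double_gt0.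
have piece (t : seq nat) : {subset t <= s} -> (k <= 3 * size t)%N ->
    k%:R / (6 * m%:R) <= \sum_(p <- t) pr_density R p.
  move=> ts kt.
  have t_pr : all prime t by apply/allP => p /ts /(allP s_pr).
  have t_le : all (leq^~ (2 ^ m)%N) t by apply/allP => p /ts /(allP s_le).
  apply: le_trans (sum_pr_density_ge t_pr t_le).
  rewrite -mul2n natrM ler_pdivrMr ?mulr_gt0 ?ltr0n //.
  rewrite [X in _ <= X](_ : _ = 3 * (size t)%:R); first by rewrite -natrM ler_nat.
  by field; rewrite pnatr_eq0 -lt0n.
have zX : ((2 ^ m) ^ 4 <= X)%N by rewrite -expnM mulnC expnM.
have := @sieve_bound R (2 ^ m) X (take k./2 s) (drop k./2 s) X0 zX.
rewrite cat_take_drop => /(_ s_u s_pr s_le).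
have := piece (take k./2 s) (fun p => @mem_take _ _ _ p).
have := piece (drop k./2 s) (fun p => @mem_drop _ _ _ p).
rewrite size_drop size_takel -/k; last by rewrite -/k; lia.
move=> /(_ ltac:(lia)) + /(_ ltac:(lia)).
rewrite -/(isum X (unsifted m)).
set S1 := \sum_(p <- take _ _) _; set S2 := \sum_(p <- drop _ _) _.
have N0 : 0 <= isum X (unsifted m) by apply: sumr_ge0 => n _; exact: unsifted_ge0.
have mR : 1 <= m%:R :> R by rewrite ler1n.
have a0 : 0 <= k%:R / (6 * m%:R) :> R by rewrite divr_ge0 // mulr_ge0.
have q0 : 0 < 2 ^+ m :> R by rewrite exprn_gt0.
have ak : 2 ^+ m / (12 * m%:R ^+ 2) <= k%:R / (6 * m%:R) :> R.
  rewrite ler_pdivrMr ?mulr_gt0 ?exprn_gt0 ?ltr0n //.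
  rewrite [X in _ <= X](_ : _ = 2 * m%:R * k%:R); last first.
    by field; rewrite pnatr_eq0 -lt0n.
  by rewrite -!natrM -natrX ler_nat.
move=> aS2 aS1 NS.
have b0 : 0 <= 2 ^+ m / (12 * m%:R ^+ 2) :> R.
  by rewrite divr_ge0 ?mulr_ge0 ?exprn_ge0.
have SS : (2 ^+ m / (12 * m%:R ^+ 2)) * (2 ^+ m / (12 * m%:R ^+ 2)) <= S1 * S2.
  by apply: ler_pM => //; exact: le_trans ak _.
have {}NS := le_trans (ler_wpM2l N0 SS) NS.
have E : 2 ^+ m / (12 * m%:R ^+ 2) * (2 ^+ m / (12 * m%:R ^+ 2)) =
    4 ^+ m / (144 * m%:R ^+ 4) :> R.
  rewrite (_ : 4 = 2 * 2) ?exprMn; last by rewrite -natrM.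
  by field; rewrite pnatr_eq0 -lt0n.
rewrite E mulrA ler_pdivrMr ?mulr_gt0 ?exprn_gt0 ?ltr0n // in NS.
rewrite mulrA ler_pdivlMr ?exprn_gt0 //; apply: le_trans NS _.
have mS : m%:R ^+ 4 <= m.+1%:R ^+ 4 :> R by rewrite lerXn2r ?nnegrE // ler_nat.
have := exprn_ge0 4 (ler0n R m).
move: (m.+1%:R ^+ 4) (m%:R ^+ 4) mS => u w wu w0.
have := ler_wpM2l (le_trans ler01 X1) wu; have := mulr_ge0 (le_trans ler01 X1) w0.
by move: (X%:R : R) => x *; nra.
Qed.

End Survivors.

(** * Least primitive roots *)

Section LeastRoot.
Variable R : realType.

Definition is_least_root (g : int) (p : nat) : Prop :=
  primitive_root_mod g p /\ forall r, primitive_root_mod g r -> (p <= r)%N.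

Lemma primitive_root_mod_prime g p : primitive_root_mod g p -> prime p.
Proof. by case/andP. Qed.

Definition least_root_min (g : int) (Y : R) : R :=
  fine (mine (least_prime_primitive_root R g) Y%:E).

Lemma least_root_minE g Y :
  mine (least_prime_primitive_root R g) Y%:E = (least_root_min g Y)%:E.
Proof.
rewrite /least_root_min /least_prime_primitive_root; case: pselect => [ex|_].
  by rewrite -EFin_min.
by rewrite minye.
Qed.

Variant least_root_min_spec g (Y : R) : R -> Type :=
| LeastRootNone of (forall p, ~~ primitive_root_mod g p) : least_root_min_spec g Y Y
| LeastRootSome p of is_least_root g p : least_root_min_spec g Y (Num.min p%:R Y).

Lemma least_root_minP g Y : least_root_min_spec g Y (least_root_min g Y).
Proof.
rewrite /least_root_min /least_prime_primitive_root; case: pselect => [ex|nex].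
  by rewrite -EFin_min /=; apply: LeastRootSome; case: ex_minnP.
by rewrite minye /=; apply: LeastRootNone => p; apply/negP => pg; apply: nex; exists p.
Qed.

(** This is p_g if p_g <= 2^m and 0 otherwise, written as a sum of periodic functions whose means
    are known. *)
Definition least_root_upto (m : nat) (g : int) : R :=
  \sum_(p <- primes_upto (2 ^ m))
     p%:R * (pr_ind R p g * survivor R (primes_upto p.-1) g).

Lemma unsifted_least g p m : is_least_root g p ->
  unsifted R m g = (2 ^ m < p)%N%:R.
Proof.
move=> [pg pmin]; rewrite /unsifted survivorE; congr (_%:R); congr nat_of_bool.
apply/allP/idP => [h|mp q].
  rewrite ltnNge; apply/negP => pm.
  by have := h p; rewrite mem_primes_upto (primitive_root_mod_prime pg) pm pg => /(_ isT).
rewrite mem_primes_upto => /andP[_ qm]; apply/negP => /pmin; lia.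
Qed.

Lemma least_root_uptoE g p m : is_least_root g p ->
  least_root_upto m g = if (p <= 2 ^ m)%N then p%:R else 0.
Proof.
move=> [pg pmin]; have p_pr := primitive_root_mod_prime pg.
have term q : pr_ind R q g * survivor R (primes_upto q.-1) g = (q == p)%:R.
  rewrite survivorE /pr_ind -natrM mulnb; congr (_%:R); congr nat_of_bool.
  apply/andP/eqP => [[qg /allP h]|->].
    apply/eqP; rewrite eqn_leq pmin // andbT leqNgt; apply/negP => pq.
    have := h p; rewrite mem_primes_upto p_pr pg /=.
    have -> : (p <= q.-1)%N by lia.
    by move=> /(_ isT).
  split=> //; apply/allP => r; rewrite mem_primes_upto => /andP[r_pr rp].
  have := prime_gt0 p_pr => p0; apply/negP => /pmin; lia.
rewrite /least_root_upto; under eq_bigr do rewrite term.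
case: ifPn => pm; last first.
  rewrite big_seq big1 // => q; rewrite mem_primes_upto => /andP[_ qm].
  by case: eqP => [qp|_]; rewrite ?mulr0 //; move: pm; rewrite -qp qm.
rewrite (bigD1_seq p) ?primes_upto_uniq ?mem_primes_upto ?p_pr //= eqxx mulr1.
by rewrite big1 ?addr0 // => q /negPf ->; rewrite mulr0.
Qed.

Lemma least_root_upto_none g m : (forall p, ~~ primitive_root_mod g p) ->
  least_root_upto m g = 0.
Proof.
move=> ng; rewrite /least_root_upto big1 // => p _.
by rewrite /pr_ind (negPf (ng p)) mul0r mulr0.
Qed.

Lemma unsifted_none g m : (forall p, ~~ primitive_root_mod g p) ->
  unsifted R m g = 1.
Proof. by move=> ng; rewrite /unsifted survivorE (introT allP). Qed.

Lemma least_root_upto_le m g : least_root_upto m g <= 2 ^+ m.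
Proof.
(* The level 0 is a dummy; what matters is the dichotomy between no primitive root and a least
   one. *)
case: (least_root_minP g 0) => [ng|p lp].
  by rewrite least_root_upto_none // exprn_ge0.
rewrite (least_root_uptoE m lp); case: ifP => pm; last by rewrite exprn_ge0.
by rewrite -natrX ler_nat.
Qed.

Lemma least_root_min_le m g Y : 0 <= Y ->
  least_root_min g Y <= least_root_upto m g + Y * unsifted R m g.
Proof.
move=> Y0; case: least_root_minP => [ng|p lp].
  by rewrite least_root_upto_none // unsifted_none // mulr1 add0r.
rewrite (least_root_uptoE m lp) (unsifted_least m lp) ltnNge.
by case: leqP => pm /=; rewrite ?mulr0 ?addr0 ?mulr1 ?add0r ge_min lexx ?orbT.
Qed.

Lemma least_root_min_ge m g Y : 2 ^+ m <= Y ->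
  least_root_upto m g <= least_root_min g Y.
Proof.
move=> mY; have Y0 : 0 <= Y by apply: le_trans mY; rewrite exprn_ge0.
case: least_root_minP => [ng|p lp]; first by rewrite least_root_upto_none.
rewrite (least_root_uptoE m lp); case: ifP => pm; last by rewrite le_min ler0n Y0.
by rewrite le_min lexx (le_trans _ mY) // -natrX ler_nat.
Qed.

(** The value changes only if 2^m < p_g <= 2^(m+1), in which case g is unsifted at level m. *)
Lemma least_root_uptoS m g :
  least_root_upto m.+1 g <= least_root_upto m g + 2 ^+ m.+1 * unsifted R m g.
Proof.
case: (least_root_minP g 0) => [ng|p lp].
  by rewrite !least_root_upto_none // add0r mulr_ge0 ?exprn_ge0 ?unsifted_ge0.
rewrite !(least_root_uptoE _ lp) (unsifted_least m lp).
have [pm|pm] := leqP p (2 ^ m).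
  by rewrite (leq_trans pm) ?leq_exp2l // mulr0 addr0.
rewrite mulr1 add0r; case: ifP => pm1; last by rewrite exprn_ge0.
by rewrite -natrX ler_nat.
Qed.

Definition partial_mean (m : nat) : R :=
  \sum_(p <- primes_upto (2 ^ m)) p%:R * delta R p.

Lemma periodic_survivor s M : all (dvdn^~ M) s ->
  periodic (survivor R s) M%:Z.
Proof.
move=> /allP sM g; rewrite /survivor !big_seq; apply: eq_bigr => p /sM pM.
by rewrite (periodic_dvd pM (periodic_pr_ind R p)).
Qed.

Lemma isum_least_root_upto m :
  exists K, forall X,
    `|isum X (least_root_upto m) - 2 * X%:R * partial_mean m| <= K.
Proof.
(* A common period for all the conditions at primes up to 2^m. *)
pose M := (2 ^ m)`!; have M0 : (0 < M)%N := fact_gt0 _.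
have dM r : prime r -> (r <= 2 ^ m)%N -> (r %| M)%N.
  by move=> r_pr rm; rewrite dvdn_fact // prime_gt0.
have per : periodic (least_root_upto m) M%:Z.
  move=> g; rewrite /least_root_upto !big_seq; apply: eq_bigr => p.
  rewrite mem_primes_upto => /andP[p_pr pm].
  rewrite (periodic_dvd (dM p p_pr pm) (periodic_pr_ind R p)).
  rewrite (periodic_survivor (M := M)) //; apply/allP => r.
  rewrite mem_primes_upto => /andP[r_pr rp]; apply: dM => //; lia.
have -> : partial_mean m = mean M (least_root_upto m).
  rewrite /least_root_upto mean_sum /partial_mean !big_seq.
  apply: eq_bigr => p; rewrite mem_primes_upto => /andP[p_pr pm].
  rewrite meanZ; congr (_ * _); apply/esym/mean_first_primitive_root => // r r_pr rp.
  by apply: dM => //; exact: leq_trans pm.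
exact: isum_periodic M0 per.
Qed.

End LeastRoot.

(** * Polynomial factors against geometric decay *)

Section Geometric.
Variable R : realType.

(** A Bernoulli-type inequality, (1 + m(1-t)) t^m <= 1, proved by induction, gives the constant
    1/(1-t). *)
Lemma natr_geometric_le (t : R) : 0 < t < 1 ->
  exists c, forall m, m.+1%:R * t ^+ m <= c.
Proof.
move=> /andP[t0 t1]; exists (1 - t)^-1 => m.
have d0 : 0 < 1 - t by rewrite subr_gt0.
have bern : (1 + m%:R * (1 - t)) * t ^+ m <= 1.
  elim: m => [|m IHm]; first by rewrite mul0r addr0 expr0 mulr1.
  apply: le_trans IHm; rewrite exprSr mulrCA mulrC ler_wpM2r ?exprn_ge0 ?(ltW t0) //.
  rewrite -[m.+1]addn1 natrD; have := ler0n R m.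
  move: (m%:R : R) => u u0; have := sqr_ge0 (1 - t).
  have := mulr_ge0 u0 (sqr_ge0 (1 - t)); rewrite !expr2; lra.
rewrite -[leRHS]mul1r ler_pdivlMr //; apply: le_trans bern.
rewrite mulrAC ler_wpM2r ?exprn_ge0 ?(ltW t0) //.
by rewrite -addn1 natrD; nra.
Qed.

Lemma natr4_geometric_le (rho : R) : 0 < rho < 1 ->
  exists c sg, [/\ 0 <= c, 0 < sg, sg < 1 &
    forall m, m.+1%:R ^+ 4 * rho ^+ m <= c * sg ^+ m].
Proof.
(* With t the eighth root of rho, one factor t^(4m) of rho^m absorbs (m+1)^4 and the other is the
   remaining decay. *)
move=> /andP[rho0 rho1]; pose t := Num.sqrt (Num.sqrt (Num.sqrt rho)).
have sqrt1 (y : R) : 0 < y < 1 -> 0 < Num.sqrt y < 1.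
  by move=> /andP[y0 y1]; rewrite sqrtr_gt0 y0 -[X in _ < X]sqrtr1 ltr_sqrt.
have t01 : 0 < t < 1 by rewrite /t !sqrt1 // rho0.
have /andP[t0 t1] := t01.
have rhoE : rho = t ^+ 4 * t ^+ 4.
  by rewrite -exprD (exprM t 2 4) (exprM _ 2 2) !sqr_sqrtr ?sqrtr_ge0 ?ltW.
have [c cE] := natr_geometric_le t01.
have c0 : 0 <= c by apply: le_trans (cE 0%N); rewrite mulr1 ler01.
exists (c ^+ 4), (t ^+ 4); split.
- by rewrite exprn_even_ge0.
- by rewrite exprn_gt0.
- by rewrite exprn_ilt1 // ltW.
move=> m; rewrite rhoE exprMn mulrA ler_wpM2r ?exprn_ge0 ?(ltW t0) //.
rewrite exprAC -exprMn lerXn2r ?nnegrE ?mulr_ge0 ?exprn_ge0 ?c0 ?(ltW t0) //.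
Qed.

Lemma geometric_small (c sg e : R) : 0 < sg < 1 -> 0 < e ->
  exists M, forall m, (M <= m)%N -> c * sg ^+ m <= e.
Proof.
move=> /andP[sg0 sg1] e0.
have sgn : `|sg| < 1 by rewrite ger0_norm // ltW.
have c1 : 0 < `|c| + 1 by rewrite ltr_wpDl.
have /cvgrPdist_le /(_ (e / (`|c| + 1))) := cvg_expr sgn.
rewrite divr_gt0 // => /(_ isT) [M _ HM]; exists M => m mM.
have := HM m mM; rewrite sub0r normrN normrX ger0_norm ?(ltW sg0) // ler_pdivlMr // mulrC.
apply: le_trans; rewrite ler_wpM2r ?exprn_ge0 ?(ltW sg0) //.
by rewrite (le_trans (ler_norm _)) // lerDl.
Qed.

End Geometric.

(** * The integers excluded from the sum *)

Section Squares.
Variable R : realType.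

Lemma square_or_small (g : int) : ~ nonsquare_set g ->
  g = -1 \/ exists k : nat, g = (k ^ 2)%N%:Z.
Proof.
move=> /not_andP[/negP|/contrapT [k ->]]; last first.
  by right; exists `|k|%N; rewrite -[in RHS]mulnn PoszM abszE -expr2 real_normK ?num_real.
rewrite -leNgt ler_norml => /andP[g1 g2].
have : g = -1 \/ g = 0 \/ g = 1 by lia.
by case=> [->|[->|->]]; [left|right; exists 0%N|right; exists 1%N].
Qed.

(** Since 0 and 1 are squares, the excluded integers are -1 and the k^2 with 0 <= k <= sqrt X, at
    most floor(sqrt X) + 2 in number. *)
Lemma isum_square_le (X : nat) :
  isum X (fun g => (~~ `[< nonsquare_set g >])%:R : R) <= Num.sqrt X%:R + 2.
Proof.
pose s := Num.truncn (Num.sqrt X%:R : R).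
pose t := [seq n%:Z - X%:Z | n <- iota 0 (2 * X).+1].
pose bad (g : int) := ~~ `[< nonsquare_set g >].
have -> : isum X (fun g => (bad g)%:R : R) = (size ([seq g <- t | bad g]))%:R.
  rewrite /isum -(big_mkord xpredT (fun n => (bad (n%:Z - X%:Z))%:R)).
  rewrite -natr_sum size_filter -sum1_count big_map /index_iota subn0.
  by congr (_%:R); rewrite [RHS]big_mkcond; apply: eq_bigr => n _; case: bad.
have ut : uniq ([seq g <- t | bad g]).
  by rewrite filter_uniq // map_inj_uniq ?iota_uniq // => m n; lia.
apply: (@le_trans _ _ (s.+2)%:R); last first.
  rewrite -addn2 natrD lerD2r; have := sqrtr_ge0 (X%:R : R).
  by move=> /truncn_itv/andP[].
rewrite ler_nat.
have -> : s.+2 = size ((-1 : int) :: [seq (k ^ 2)%N%:Z | k <- iota 0 s.+1]).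
  by rewrite /= size_map size_iota.
apply: uniq_leq_size ut _ => g; rewrite mem_filter => /andP[/asboolPn /square_or_small].
case=> [-> _|[k ->]]; first by rewrite inE eqxx.
move=> /mapP[n]; rewrite mem_iota => nX kE; rewrite inE; apply/orP; right.
apply/map_f; rewrite mem_iota /= add0n ltnS truncn_ge_nat ?sqrtr_ge0 //.
have kX : (k ^ 2 <= X)%N by lia.
by rewrite -(ler_sqr (ler0n _ _)) ?nnegrE ?sqrtr_ge0 // sqr_sqrtr // -natrX ler_nat.
Qed.

End Squares.

(** * Passage to the limit *)

Section Average.
Variable R : realType.

Lemma fsum_nonsquares (x Y : R) : 0 <= x ->
  (\sum_(g \in nonsquares_upto x) mine (least_prime_primitive_root R g) Y%:E =
   (isum (Num.truncn x) (fun g =>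
      if `[< nonsquare_set g >] then least_root_min g Y else 0))%:E)%E.
Proof.
move=> x0; pose t := [seq n%:Z - (Num.truncn x)%:Z | n <- iota 0 (2 * Num.truncn x).+1].
have ut : uniq t by rewrite map_inj_uniq ?iota_uniq // => m n; lia.
have -> : nonsquares_upto x = nonsquare_set `&` [set` t].
  apply/seteqP; split => g /= [nsg gx]; split => //.
    have gX : (`|g| <= Num.truncn x)%N.
      by rewrite truncn_ge_nat // pmulrn abszE.
    apply/mapP; exists (absz (g + (Num.truncn x)%:Z)); last by lia.
    by rewrite mem_iota; lia.
  move: gx => /mapP[n]; rewrite mem_iota => nX gE.
  have : (`|g| <= Num.truncn x)%N by lia.
  by rewrite truncn_ge_nat // pmulrn abszE.
rewrite fsbig_mkcondl -fsbig_seq // big_map -[RHS]sumEFin.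
rewrite -[in RHS](big_mkord xpredT (fun n =>
  (if `[< nonsquare_set (n%:Z - (Num.truncn x)%:Z) >] then
     least_root_min (n%:Z - (Num.truncn x)%:Z) Y else 0)%:E)) /index_iota subn0.
apply: eq_bigr => n _; rewrite least_root_minE; case: asboolP => ns.
  by rewrite mem_set.
by rewrite memNset.
Qed.

(** Each dyadic step costs 2^(j+1) times the number of unsifted g, which is O(X (j+1)^4 / 2^j);
    these costs are summable with geometric tails. *)
Lemma isum_least_root_tail : exists C sg : R,
  [/\ 0 <= C, 0 < sg, sg < 1 &
    forall m k X, (0 < X)%N -> (16 ^ (m + k) <= X)%N ->
      isum X (least_root_upto R (m + k)) <=
        isum X (least_root_upto R m) + X%:R * (C * sg ^+ m)].
Proof.
have half01 : 0 < (2^-1 : R) < 1 by apply/andP; split; lra.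
have [c [sg [c0 sg0 sg1 cE]]] := natr4_geometric_le half01.
have dsg : 0 < 1 - sg by rewrite subr_gt0.
have [K K0 unsK] := isum_unsifted R.
pose C := 2 * K * c / (1 - sg).
have C0 : 0 <= C by rewrite /C divr_ge0 ?(ltW dsg) // mulr_ge0 // mulr_ge0.
exists C, sg; split=> // m k X X0 mkX.
(* The extra term makes the induction telescope: [C] is chosen with 2Kc = C (1 - sg), so one step
   costs at most X C (sg^j - sg^(j+1)). *)
suff H : isum X (least_root_upto R (m + k)) + X%:R * (C * sg ^+ (m + k)) <=
    isum X (least_root_upto R m) + X%:R * (C * sg ^+ m).
  apply: le_trans H; rewrite lerDl mulr_ge0 // mulr_ge0 //.
  by rewrite exprn_ge0 // ltW.
elim: k mkX => [|k IHk] mkX; first by rewrite addn0.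
have mkX' : (16 ^ (m + k) <= X)%N.
  by apply: leq_trans mkX; rewrite leq_exp2l // addnS.
apply: le_trans (IHk mkX'); rewrite addnS; set j := (m + k)%N in mkX' *.
have stepj : isum X (least_root_upto R j.+1) <=
    isum X (least_root_upto R j) + 2 ^+ j.+1 * isum X (unsifted R j).
  by rewrite -isumZ -isumD; apply: ler_isum => g; exact: least_root_uptoS.
have := unsK _ _ X0 mkX'.
have e2 : 0 < 2 ^+ j.+1 :> R by rewrite exprn_gt0.
move/(ler_wpM2l (ltW e2)) => unsj.
have cj := cE j.
have E4 : 2 ^+ j.+1 * (K * X%:R * (j.+1%:R ^+ 4 / 4 ^+ j)) =
    2 * K * X%:R * (j.+1%:R ^+ 4 * 2^-1 ^+ j) :> R.
  rewrite (_ : 4 = 2 * 2 :> R) ?exprMn; last by rewrite -natrM.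
  by rewrite exprS exprVn; field; rewrite expf_neq0.
rewrite E4 in unsj.
have XR : 0 <= 2 * K * X%:R :> R by rewrite mulr_ge0 // mulr_ge0.
have h3 := ler_wpM2l XR cj.
have CE : 2 * K * c = C * (1 - sg) by rewrite /C divfK // gt_eqF.
have E5 : 2 * K * X%:R * (c * sg ^+ j) = X%:R * (C * (1 - sg)) * sg ^+ j.
  by rewrite -CE; ring.
rewrite E5 in h3.
apply: le_trans (lerD (le_trans stepj (lerD (lexx _) (le_trans unsj h3))) (lexx _)) _.
by rewrite exprS -!addrA lerD2l le_eqVlt; apply/orP; left; apply/eqP; ring.
Qed.

Lemma delta_ge0 p : 0 <= delta R p.
Proof.
rewrite /delta mulr_ge0 ?divr_ge0 //; apply: prodr_ge0 => r _.
by rewrite subr_ge0 subn1; exact: pr_density_le1.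
Qed.

(** The tail estimate passes from averages to densities by taking X large. A gap d > C sg^m would
    give 2Xd <= K1 + K2 + X C sg^m, which fails once Xd > K1 + K2. *)
Lemma partial_mean_tail (C sg : R) : 0 <= C -> 0 < sg ->
  (forall m k X, (0 < X)%N -> (16 ^ (m + k) <= X)%N ->
      isum X (least_root_upto R (m + k)) <=
        isum X (least_root_upto R m) + X%:R * (C * sg ^+ m)) ->
  forall m k, partial_mean R (m + k) <= partial_mean R m + C * sg ^+ m.
Proof.
move=> C0 sg0 H m k; rewrite -lerBlDl leNgt; apply/negP.
set d := _ - _ => Cd.
have Cs0 : 0 <= C * sg ^+ m by rewrite mulr_ge0 // exprn_ge0 // ltW.
have d0 : 0 < d by apply: le_lt_trans Cd.
have [K1 HK1] := isum_least_root_upto R m.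
have [K2 HK2] := isum_least_root_upto R (m + k).
pose X := (Num.truncn ((K1 + K2) / d)).+1.
pose X' := (X + 16 ^ (m + k))%N.
have X'0 : (0 < X')%N by rewrite /X' /X addSn.
have := H m k X' X'0 (leq_addl _ _).
have := HK1 X'; have := HK2 X'; rewrite !ler_norml => /andP[h1 _] /andP[_ h2] h3.
have : K1 + K2 < X'%:R * d.
  rewrite -ltr_pdivrMr //; apply: lt_le_trans (truncnS_gt _) _.
  by rewrite ler_nat leq_addr.
have XR : 0 < X'%:R :> R by rewrite ltr0n.
have := ltr_pM2l XR (C * sg ^+ m) d; rewrite Cd.
have dE : partial_mean R (m + k) = partial_mean R m + d by rewrite /d; ring.
move: h1 h2 h3; rewrite dE.
move: (isum X' _) (isum X' (least_root_upto R m)) (C * sg ^+ m) (X'%:R : R).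
move: (partial_mean R m) => p a b c x h1 h2 h3 h4 h5; nra.
Qed.

End Average.

(** * Convergence of the series, and the upper and lower estimates for the average *)

Section Limit.
Variable R : realType.

Lemma series_partial_mean (C sg : R) :
  (forall m k, partial_mean R (m + k) <= partial_mean R m + C * sg ^+ m) ->
  exists s, (\sum_(0 <= p <oo | prime p) (p%:R * delta R p)%:E = s%:E)%E /\
    forall m, partial_mean R m <= s <= partial_mean R m + C * sg ^+ m.
Proof.
move=> tail; pose u p : \bar R := (p%:R * delta R p)%:E.
have u0 p : (0 <= u p)%E by rewrite lee_fin mulr_ge0 // delta_ge0.
have pmE m : (\sum_(0 <= p < (2 ^ m).+1 | prime p) u p = (partial_mean R m)%:E)%E.
  by rewrite -big_filter sumEFin /index_iota subn0.
have lb m : ((partial_mean R m)%:E <= \sum_(0 <= p <oo | prime p) u p)%E.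
  by rewrite -pmE; apply: nneseries_lim_ge.
have ub m : (\sum_(0 <= p <oo | prime p) u p <= (partial_mean R m + C * sg ^+ m)%:E)%E.
  apply: lime_le; first exact: is_cvg_nneseries.
  near=> n; have mn : (m <= n)%N by near: n; exists m.
  (* Nonnegativity of the terms allows an arbitrary cut n to be enlarged to the dyadic cut 2^n. *)
  have le2 : (n <= (2 ^ n).+1)%N by rewrite ltnW // ltnS ltnW // ltn_expl.
  apply: le_trans (@lee_sum_nneg_natr R u prime 0 (fun k _ _ => u0 k) _ _ le2) _.
  by rewrite pmE lee_fin -(subnKC mn) tail.
have : (\sum_(0 <= p <oo | prime p) u p)%E \is a fin_num.
  rewrite ge0_fin_numE; first by apply: le_lt_trans (ub 0%N) _; rewrite ltry.
  by apply: nneseries_ge0.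
move=> /fineK sE; exists (fine (\sum_(0 <= p <oo | prime p) u p)%E); split=> // m.
by rewrite -!lee_fin sE lb ub.
Unshelve. all: by end_near. Qed.

(** Here eta < 1/2 enters: as X grows by 16, x^eta grows by 16^eta, while the sieve gains a factor 4
    up to powers of m. *)
Lemma powR16_lt4 (eta : R) : eta < 2^-1 -> 16 `^ eta < 4.
Proof.
move=> eta2; have -> : 4 = 16 `^ 2^-1 :> R.
  rewrite powR12_sqrt // (_ : 16 = 4 ^+ 2) ?sqrtr_sqr ?ger0_norm //.
  by rewrite -natrX.
by rewrite /powR pnatr_eq0 /= ltr_expR ltr_pM2r // ln_gt0 // ltr1n.
Qed.

Lemma powR_le_pow16 (eta x : R) : 0 <= eta -> 1 <= x ->
  x `^ eta <= (16 `^ eta) ^+ (trunc_log 16 (Num.truncn x)).+1.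
Proof.
move=> eta0 x1; set m := trunc_log _ _.
have x0 : 0 <= x by apply: le_trans x1.
have -> : (16 `^ eta) ^+ m.+1 = (16 ^+ m.+1) `^ eta :> R.
  by rewrite -powR_mulrn ?powR_ge0 // powRAC powR_mulrn.
rewrite ge0_ler_powR ?nnegrE ?exprn_ge0 // ltW //.
apply: lt_le_trans (truncnS_gt x) _.
by rewrite -natrX ler_nat trunc_log_ltn.
Qed.

Definition truncated_sum (eta x : R) : R :=
  isum (Num.truncn x) (fun g =>
    if `[< nonsquare_set g >] then least_root_min g (x `^ eta) else 0).

Lemma least_root_min_ge0 g (Y : R) : 0 <= Y -> 0 <= least_root_min g Y.
Proof. by move=> Y0; case: least_root_minP => // p _; rewrite le_min ler0n Y0. Qed.

Lemma truncated_sum_upper (eta s : R) : 0 < eta -> eta < 2^-1 ->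
  (forall m, partial_mean R m <= s) ->
  forall e, 0 < e -> \forall x \near +oo, truncated_sum eta x <= 2 * x * (s + e).
Proof.
move=> eta0 eta2 Ps e e0.
have [C [sg [C0 sg0 sg1 tailX]]] := isum_least_root_tail R.
have s_ge0 : 0 <= s.
  apply: le_trans (Ps 0%N); apply: sumr_ge0 => p _.
  by rewrite mulr_ge0 // delta_ge0.
have e2 : 0 < e / 2 by rewrite divr_gt0.
have [m mE] : exists m, C * sg ^+ m <= e / 2.
  have sg01 : 0 < sg < 1 by rewrite sg0.
  by have [m mE] := geometric_small C sg01 e2; exists m; exact: mE.
have [K KE] := isum_least_root_upto R m.
pose q : R := 16 `^ eta.
have q0 : 0 < q by rewrite powR_gt0.
have rho01 : 0 < q / 4 < 1.
  by rewrite divr_gt0 //= ltr_pdivrMr // mul1r powR16_lt4.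
have [c [sg' [c0 sg'0 sg'1 cE]]] := natr4_geometric_le rho01.
have [K0 K0_ge0 unsK] := isum_unsifted R.
have [M ME] : exists M, forall m, (M <= m)%N -> K0 * q * c * sg' ^+ m <= e / 2.
  by apply: geometric_small e2; rewrite sg'0.
near=> x.
have x1 : 1 <= x by near: x; apply: nbhs_pinfty_ge.
have xbig : (16 ^ (m + M))%N%:R <= x by near: x; apply: nbhs_pinfty_ge.
have xK : K / e <= x by near: x; apply: nbhs_pinfty_ge; rewrite num_real.
have x0 : 0 <= x by apply: le_trans x1.
rewrite /truncated_sum; set Y := x `^ eta; set X := Num.truncn x.
have Y0 : 0 <= Y by rewrite powR_ge0.
have X0 : (0 < X)%N by rewrite truncn_gt0.
have Xx : X%:R <= x by rewrite truncn_le.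
have XR : 0 <= X%:R :> R by [].
(* The highest level at which the sieve bound is available, so that 2^m1 is about X^(1/4). *)
pose m1 := trunc_log 16 X.
have mM : (m + M <= m1)%N by rewrite trunc_log_max // truncn_ge_nat.
have m1X : (16 ^ m1 <= X)%N by rewrite trunc_logP.
have step1 : isum X (fun g => if `[< nonsquare_set g >] then least_root_min g Y else 0) <=
    isum X (least_root_upto R m1) + Y * isum X (unsifted R m1).
  rewrite -isumZ -isumD; apply: ler_isum => g.
  apply: le_trans (least_root_min_le m1 g Y0); case: ifP => // _.
  exact: least_root_min_ge0.
have mm1 : (m + (m1 - m) = m1)%N by rewrite subnKC // (leq_trans _ mM) // leq_addr.
have step2 : isum X (least_root_upto R m1) <=
    isum X (least_root_upto R m) + X%:R * (C * sg ^+ m).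
  by have := tailX m (m1 - m)%N X X0; rewrite mm1; apply.
have step3 : isum X (least_root_upto R m) <= 2 * X%:R * s + K.
  have := KE X; rewrite ler_norml => /andP[_]; rewrite lerBlDl => h.
  by apply: le_trans h _; rewrite lerD2r ler_wpM2l // mulr_ge0.
have step4 : Y * isum X (unsifted R m1) <= X%:R * (e / 2).
  apply: le_trans (ler_wpM2l Y0 (unsK _ _ X0 m1X)) _.
  have Yq : Y <= q ^+ m1.+1 by apply: powR_le_pow16 => //; exact: ltW.
  have nn : 0 <= K0 * X%:R * (m1.+1%:R ^+ 4 / 4 ^+ m1).
    by rewrite !mulr_ge0 ?invr_ge0 ?exprn_ge0.
  apply: le_trans (ler_wpM2r nn Yq) _.
  have -> : q ^+ m1.+1 * (K0 * X%:R * (m1.+1%:R ^+ 4 / 4 ^+ m1)) =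
      X%:R * (K0 * q * (m1.+1%:R ^+ 4 * (q / 4) ^+ m1)).
    by rewrite exprS expr_div_n; ring.
  rewrite ler_wpM2l //; apply: le_trans (ME m1 _); last first.
    by rewrite (leq_trans _ mM) // leq_addl.
  by rewrite -[leRHS]mulrA ler_wpM2l // mulr_ge0 // ltW.
(* Of the allowance 2xe, the periodic error K takes xe, and the dyadic tail and the unsifted g take
   xe/2 each. *)
have xK' : K <= x * e by rewrite -ler_pdivrMr.
have step5 := ler_wpM2l XR mE.
have XE := ler_wpM2r (ltW e0) Xx; have Xs := ler_wpM2r s_ge0 Xx.
apply: le_trans step1 _; apply: le_trans (lerD step2 step4) _.
apply: le_trans (lerD (lerD step3 step5) (lexx _)) _; lra.
Unshelve. all: by end_near. Qed.

Lemma truncated_sum_lower (eta s : R) : 0 < eta ->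
  (forall e, 0 < e -> exists m, s - e <= partial_mean R m) ->
  forall e, 0 < e -> \forall x \near +oo, 2 * x * (s - e) <= truncated_sum eta x.
Proof.
move=> eta0 sP e e0.
have [|m mE] := sP (e / 4); first by rewrite divr_gt0.
have [K KE] := isum_least_root_upto R m.
pose a : R := 2 ^+ m; have a0 : 0 < a by rewrite exprn_gt0.
pose P := partial_mean R m; rewrite -/P in mE.
have P0 : 0 <= P by apply: sumr_ge0 => p _; rewrite mulr_ge0 // delta_ge0.
(* The lower-order losses: a^2/e and 2a from the excluded integers, K from periodicity, 2P from
   replacing X by x <= X + 1. *)
pose B := a ^+ 2 / e + 2 * a + K + 2 * P.
near=> x.
have x1 : 1 <= x by near: x; apply: nbhs_pinfty_ge.
(* This ensures 2^m <= x^eta, so truncation does not affect primitive roots up to 2^m. *)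
have xa : a `^ eta^-1 <= x by near: x; apply: nbhs_pinfty_ge; rewrite num_real.
have xB : B / e <= x by near: x; apply: nbhs_pinfty_ge; rewrite num_real.
have x0 : 0 <= x by apply: le_trans x1.
rewrite /truncated_sum; set Y := x `^ eta; set X := Num.truncn x.
have Xx : X%:R <= x by rewrite truncn_le.
have xX : x <= X%:R + 1 by rewrite natr1 ltW // truncnS_gt.
have aY : a <= Y.
  have -> : a = (a `^ eta^-1) `^ eta.
    by rewrite -powRrM mulVf ?gt_eqF // powRr1 // ltW.
  by apply: ge0_ler_powR; rewrite ?nnegrE ?powR_ge0 // ltW.
have Y0 : 0 <= Y by rewrite powR_ge0.
set T := isum X _.
have step1 : isum X (least_root_upto R m) <= T + a * (Num.sqrt X%:R + 2).
  apply: le_trans (_ : T + a * isum X (fun g => (~~ `[< nonsquare_set g >])%:R) <= _).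
    rewrite -isumZ -isumD; apply: ler_isum => g.
    case: (boolP `[< _ >]) => _ /=; first by rewrite mulr0 addr0 least_root_min_ge.
    by rewrite mulr1 add0r least_root_upto_le.
  by rewrite lerD2l ler_wpM2l ?(ltW a0) // isum_square_le.
have step2 : 2 * X%:R * P - K <= isum X (least_root_upto R m).
  by have := KE X; rewrite ler_norml lerBrDl => /andP[].
have r2 : Num.sqrt (X%:R : R) ^+ 2 = X%:R by rewrite sqr_sqrtr.
(* Taken at r = sqrt X, this absorbs the loss a sqrt X from the squares into Xe/2 plus a
   constant. *)
have amgm r : a * r <= e / 2 * r ^+ 2 + a ^+ 2 / e.
  rewrite -subr_ge0; have -> : e / 2 * r ^+ 2 + a ^+ 2 / e - a * r =
      e / 2 * ((r - a / e) ^+ 2 + (a / e) ^+ 2).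
    by field; rewrite gt_eqF.
  by rewrite mulr_ge0 ?addr_ge0 ?sqr_ge0 // divr_ge0 // ltW.
have xB' : B <= x * e by rewrite -ler_pdivrMr.
have Xe := ler_wpM2l (ltW e0) Xx.
have XP := ler_wpM2r P0 xX; have xs := ler_wpM2l x0 mE.
have := amgm (Num.sqrt X%:R); rewrite r2.
move: xB'; rewrite /B; lra.
Unshelve. all: by end_near. Qed.

End Limit.

Theorem theorem1p4 (R : realType) (eta : R) (eta_gt0 : 0 < eta)
    (eta_lt_half : eta < 2^-1) :
  (\sum_(0 <= p <oo | prime p) (p%:R * delta R p)%:E < +oo)%E /\
  (((2 * x)^-1)%:E *
     \sum_(g \in nonsquares_upto x)
        mine (least_prime_primitive_root R g) (x `^ eta)%:E)%E @[x --> +oo%R]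
    --> (\sum_(0 <= p <oo | prime p) (p%:R * delta R p)%:E)%E.
Proof.
have [C [sg [C0 sg0 sg1 tailX]]] := isum_least_root_tail R.
have [s [sE sP]] := series_partial_mean (partial_mean_tail C0 sg0 tailX).
rewrite sE; split; first by rewrite ltry.
apply/fine_cvgP; split.
  near=> x; rewrite fsum_nonsquares //; near: x; exact: nbhs_pinfty_ge.
apply/cvgrPdist_le => e e0.
have low d : 0 < d -> exists m, s - d <= partial_mean R m.
  move=> d0; have sg01 : 0 < sg < 1 by rewrite sg0.
  have [m mE] := geometric_small C sg01 d0; exists m.
  have := mE m (leqnn m); have /andP[_] := sP m; lra.
have up m : partial_mean R m <= s by have /andP[] := sP m.
near=> x.
have x0 : 0 < x by near: x; exact: nbhs_pinfty_gt.
rewrite /= (fsum_nonsquares _ (ltW x0)) -EFinM /= -/(truncated_sum eta x).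
have upx : truncated_sum eta x <= 2 * x * (s + e).
  by near: x; exact: truncated_sum_upper.
have lox : 2 * x * (s - e) <= truncated_sum eta x.
  by near: x; exact: truncated_sum_lower.
have x2 : 0 < 2 * x by rewrite mulr_gt0.
rewrite distrC ler_distl ![_^-1 * _]mulrC.
by rewrite ler_pdivlMr // ler_pdivrMr // ![_ * (2 * x)]mulrC lox upx.
Unshelve. all: by end_near. Qed.
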